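(* Let $\mathcal{F}^\omega$ and $\mathcal{G}^\nu$ be weighted species with $\mathcal{G}[\emptyset]=\emptyset$, such that $[z^k]\tilde{\mathcal{F}}^\omega(z)>0$ for at least one $k\ge 1$ and $\widetilde{\mathcal{F}^\omega\circ\mathcal{G}^\nu}(z)$ is not a polynomial. Let $\rho$ be the radius of convergence of $\tilde{\mathcal{G}}^\nu(z)$ and assume that for some $\epsilon>0$ \[ Z_{\mathcal{F}^\omega}\big(\tilde{\mathcal{G}}^\nu(\rho)+\epsilon,\ \tilde{\mathcal{G}}^{\nu^2}((\rho+\epsilon)^2),\ \tilde{\mathcal{G}}^{\nu^3}((\rho+\epsilon)^3),\ldots\big)<\infty . \] Let $\mathsf{R}_n$ (the remainder after deleting a largest component of the random unlabelled composite structure $\mathsf{S}_n$ of size $n$) and $\mathsf{R}$ (the Boltzmann-distributed unlabelled $\mathcal{F}'\circ\mathcal{G}$-object at parameter $\rho$) be as described in the context. If the series $\tilde{\mathcal{G}}^\nu(z)$ belongs to the class $\mathscr{S}_d$ for some integer $d\ge1$, then \[ d_{\mathrm{TV}}(\mathsf{R}_n,\mathsf{R})\to 0 \qquad\text{as } n\to\infty,\ n\equiv 0 \bmod d. \]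
   Context: A weighted species $\mathcal{F}^\omega$ assigns to each finite set $U$ a finite set $\mathcal{F}[U]$ of structures (with $\mathcal{F}[U]\cap\mathcal{F}[V]=\emptyset$ for $U\neq V$) and a weight map $\omega_U:\mathcal{F}[U]\to\mathbb{R}_{\ge0}$, and to each bijection $\sigma:U\to V$ a weight-preserving bijection $\mathcal{F}[\sigma]:\mathcal{F}[U]\to\mathcal{F}[V]$, functorially. The size of $F\in\mathcal{F}[U]$ is $|U|$. The symmetric group on $U$ acts on $\mathcal{F}[U]$ by $\sigma.F=\mathcal{F}[\sigma](F)$; orbits are called unlabelled objects and have well-defined size and weight. $\mathscr{U}_k(\mathcal{F})$ denotes the set of orbits on $\mathcal{F}[\{1,\dots,k\}]$ and $\mathscr{U}(\mathcal{F})=\bigcup_{k\ge0}\mathscr{U}_k(\mathcal{F})$. The ordinary generating series is $\tilde{\mathcal{F}}^\omega(z)=\sum_{\tilde F\in\mathscr{U}(\mathcal{F})}\omega(\tilde F)z^{|\tilde F|}$. A symmetry is a pair $(F,\sigma)$ with $\sigma.F=F$; the cycle index series is $Z_{\mathcal{F}^\omega}(z_1,z_2,\ldots)=\sum_{k\ge0}\sum_{(F,\sigma)}\frac{\omega(F)}{k!}z_1^{\sigma_1}\cdots z_k^{\sigma_k}$, the inner sum over symmetries with $F\in\mathcal{F}[\{1,\dots,k\}]$, and $\sigma_i$ the number of $i$-cycles of $\sigma$. For a weighting $\nu$, $\nu^i$ denotes the weighting $G\mapsto\nu(G)^i$. Composition: if $\mathcal{G}[\emptyset]=\emptyset$, the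 species $\mathcal{F}^\omega\circ\mathcal{G}^\nu$ has as structures on $U$ the tuples $(F,(G_Q)_{Q\in\pi})$ where $\pi$ is a partition of $U$ into nonempty classes, $F\in\mathcal{F}[\pi]$ and $G_Q\in\mathcal{G}[Q]$, with weight $\mu=\omega(F)\prod_{Q}\nu(G_Q)$ and the natural transport along bijections; the classes $Q$ are called components. Its ordinary generating series is $Z_{\mathcal{F}^\omega}(\tilde{\mathcal{G}}^\nu(z),\tilde{\mathcal{G}}^{\nu^2}(z^2),\ldots)$. Derived species: $\mathcal{F}'[U]=\mathcal{F}[U\cup\{*\}]$ with $*$ a placeholder not in $U$ and not counted in the size, weight inherited from $\mathcal{F}$, transport via extending bijections by $*\mapsto*$; its cycle index series is $\frac{\partial}{\partial z_1}Z_{\mathcal{F}^\omega}$. Random objects: for $n$ with $[z^n]\widetilde{\mathcal{F}^\omega\circ\mathcal{G}^\nu}(z)>0$, $\mathsf{S}_n=(\mathsf{F}_n,(\mathsf{G}_Q)_{Q\in\pi_n})$ is drawn from $\mathscr{U}_n(\mathcal{F}\circ\mathcal{G})$ with probability proportional to its $\mu$-weight. Taking any representative, choose uniformly at random a component $Q_0\in\pi_n$ of maximal size, relabel $Q_0$ in $\mathsf{F}_n$ to the placeholder $*$ (giving an $\mathcal{F}'$-structure $\mathsf{F}_n'$ on $\pi_n\setminus\{Q_0\}$), and let $\mathsf{R}_n$ be the unlabelled $\mathcal{F}'\circ\mathcal{G}$-object $(\mathsf{F}_n',(\mathsf{G}_Q)_{Q\in\pi_n\setminus\{Q_0\}})$.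 $\mathsf{R}$ is a random element of $\mathscr{U}(\mathcal{F}'\circ\mathcal{G})$ with $\mathbb{P}(\mathsf{R}=R)=\mu(R)\rho^{|R|}/\widetilde{(\mathcal{F}')^\omega\circ\mathcal{G}^\nu}(\rho)$. Class $\mathscr{S}_d$: a power series $g(z)=\sum g_nz^n$ with non-negative coefficients and radius of convergence $\rho>0$ belongs to $\mathscr{S}_d$ if $g_n=0$ whenever $d\nmid n$, and as $n\to\infty$ with $n\equiv0\bmod d$: $g_n/g_{n+d}\to\rho^d$ and $\frac{1}{g_n}\sum_{i+j=n}g_ig_j\to 2g(\rho)<\infty$. $d_{\mathrm{TV}}(X,Y)=\sup_{\mathcal{E}}|\mathbb{P}(X\in\mathcal{E})-\mathbb{P}(Y\in\mathcal{E})|$ for random variables on a countable space. *)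

(* Defs.v *)
From HB Require Import structures.
From mathcomp Require Import all_boot all_order all_algebra all_fingroup.
From mathcomp Require Import all_classical all_reals all_analysis.
Set Implicit Arguments.
Unset Strict Implicit.
Unset Printing Implicit Defensive.
Import Order.TTheory GRing.Theory Num.Theory.
Import numFieldNormedType.Exports.
Local Open Scope ring_scope.

Record bijection (U V : Type) := Bijection {
  bij_fun :> U -> V;
  bij_inv : V -> U;
  bij_funK : cancel bij_fun bij_inv;
  bij_invK : cancel bij_inv bij_fun }.

Lemma bijection_ext (U V : Type) (b c : bijection U V) : b =1 c -> b = c.
Proof.
case: b c => [f f' fK f'K] [g g' gK g'K] /= fg.
have e : f = g by apply: funext.
subst g.
have e' : f' = g' by apply: funext => y; rewrite -{1}(g'K y) fK.
subst g'.
by congr Bijection; apply: Prop_irrelevance.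
Qed.

Definition bij_id (U : Type) : bijection U U :=
  @Bijection U U id id (fun=> erefl) (fun=> erefl).

Definition bij_comp (U V W : Type) (b : bijection U V) (c : bijection V W) :
    bijection U W :=
  @Bijection U W (c \o b) (bij_inv b \o bij_inv c)
    (can_comp (bij_funK c) (bij_funK b))
    (can_comp (bij_invK b) (bij_invK c)).

Definition bij_sym (U V : Type) (b : bijection U V) : bijection V U :=
  Bijection (bij_invK b) (bij_funK b).

Definition bij_perm (T : finType) (s : {perm T}) : bijection T T :=
  Bijection (permK s) (permKV s).

Definition bij_enum (T : finType) : bijection T 'I_#|T| :=
  Bijection (@enum_rankK T) (@enum_valK T).

Lemma omap_cancel (U V : Type) (f : U -> V) (g : V -> U) :
  cancel f g -> cancel (omap f) (omap g).
Proof. by move=> fK [x|] //=; rewrite fK. Qed.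

Definition bij_option (U V : Type) (b : bijection U V) :
    bijection (option U) (option V) :=
  Bijection (omap_cancel (bij_funK b)) (omap_cancel (bij_invK b)).

Section BijectionOfSurjection.
Variables (U : finType) (V : eqType) (f : U -> V).
Hypotheses (f_inj : injective f) (f_surj : forall y, y \in codom f).

Lemma iinv_cancel : cancel f (fun y => iinv (f_surj y)).
Proof. by move=> x; apply: f_inj; rewrite f_iinv. Qed.

Lemma iinv_cancelV : cancel (fun y => iinv (f_surj y)) f.
Proof. by move=> y; rewrite f_iinv. Qed.

Definition bij_of_surj : bijection U V := Bijection iinv_cancel iinv_cancelV.
End BijectionOfSurjection.

Lemma imset_cancel (U V : finType) (f : U -> V) (g : V -> U) :
  cancel f g -> cancel (fun A : {set U} => f @: A) (fun B : {set V} => g @: B).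
Proof.
move=> fK A; rewrite -imset_comp -[RHS]imset_id.
by apply: eq_imset => x /=; rewrite fK.
Qed.

Definition bij_set (U V : finType) (b : bijection U V) :
    bijection {set U} {set V} :=
  Bijection (imset_cancel (bij_funK b)) (imset_cancel (bij_invK b)).

Definition pts (U : finType) (A : {set U}) : finType := {x : U | x \in A}.

Definition Pts (U : finType) (A : {set U}) (x : U) (xA : x \in A) : pts A :=
  exist (fun x => x \in A) x xA.

Section Restriction.
Variables (U V : finType) (b : bijection U V) (A : {set U}) (B : {set V}).
Hypothesis BE : B = b @: A.

Lemma restr_in (x : pts A) : b (val x) \in B.
Proof. by rewrite BE; apply: imset_f; apply: valP. Qed.

Lemma restr_inv_in (y : pts B) : bij_inv b (val y) \in A.
Proof.
by case: y => y /=; rewrite BE => /imsetP[x xA ->]; rewrite bij_funK.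
Qed.

Definition restr_fun (x : pts A) : pts B := Pts (restr_in x).
Definition restr_inv (y : pts B) : pts A :=
  Pts (restr_inv_in y).

Lemma restr_funK : cancel restr_fun restr_inv.
Proof. by move=> x; apply: val_inj; rewrite /= bij_funK. Qed.

Lemma restr_invK : cancel restr_inv restr_fun.
Proof. by move=> y; apply: val_inj; rewrite /= bij_invK. Qed.

Definition bij_restr : bijection (pts A) (pts B) :=
  Bijection restr_funK restr_invK.
End Restriction.

(* Distinct label sets are distinct types, so the convention that structures
   on different sets are different is built into the typing. *)
Record wspecies (R : realType) := WSpecies {
  str :> finType -> finType;
  weight : forall U : finType, str U -> R;
  weight_ge0 : forall (U : finType) (x : str U), 0 <= weight x;
  transport : forall U V : finType, bijection U V -> str U -> str V;
  transport_id : forall (U : finType) (x : str U), transport (bij_id U) x = x;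
  transport_comp : forall (U V W : finType) (b : bijection U V)
      (c : bijection V W) (x : str U),
    transport (bij_comp b c) x = transport c (transport b x);
  weight_transport : forall (U V : finType) (b : bijection U V) (x : str U),
    weight (transport b x) = weight x }.

Arguments weight {R} w {U} x.
Arguments transport {R} w {U V} b x.
Arguments transport_id {R} w {U} x.
Arguments transport_comp {R} w {U V W} b c x.
Arguments weight_transport {R} w {U V} b x.
Arguments weight_ge0 {R} w {U} x.

Lemma transport_idE (R : realType) (F : wspecies R) (U : finType)
  (b : bijection U U) (x : F U) : b =1 id -> transport F b x = x.
Proof.
by move=> b1; rewrite (_ : b = bij_id U) ?transport_id//; exact: bijection_ext.
Qed.

Lemma eq_transport (R : realType) (F : wspecies R) (U V : finType)
  (b c : bijection U V) (x : F U) : b =1 c -> transport F b x = transport F c x.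
Proof. by move=> bc; rewrite (bijection_ext bc). Qed.

Definition species_pow (R : realType) (G : wspecies R) (i : nat) : wspecies R.
Proof.
refine (@WSpecies R (str G) (fun U x => weight G x ^+ i) _ (@transport R G)
  (@transport_id R G) (@transport_comp R G) _).
- by move=> U x; apply: exprn_ge0; apply: weight_ge0.
- by move=> U V b x; rewrite weight_transport.
Defined.

Definition derived (R : realType) (F : wspecies R) : wspecies R.
Proof.
refine (@WSpecies R (fun U => str F (option U)) (fun U x => weight F x) _
  (fun U V b x => transport F (bij_option b) x) _ _ _).
- by move=> U x; apply: weight_ge0.
- by move=> U x; apply: transport_idE; case.
- by move=> U V W b c x; rewrite -transport_comp; apply: eq_transport; case.
- by move=> U V b x; apply: weight_transport.
Defined.

(* [finset.partition] requires the classes to be nonempty. *)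
Definition set_partition (U : finType) : finType :=
  {p : {set {set U}} | finset.partition p [set: U]}.

Lemma imset_set_partition (U V : finType) (b : bijection U V)
  (p : set_partition U) : finset.partition (bij_set b @: val p) [set: V].
Proof.
have bI : injective b := can_inj (bij_funK b).
have bT : [set: V] = b @: [set: U].
  apply/setP => y; rewrite inE; apply/esym/imsetP.
  by exists (bij_inv b y); rewrite ?bij_invK.
by rewrite bT (imset_partition _ _ bI); exact: (valP p).
Qed.

Definition set_partition_image (U V : finType) (b : bijection U V)
  (p : set_partition U) : set_partition V :=
  exist (fun q : {set {set V}} => finset.partition q [set: V]) _
    (imset_set_partition b p).

Section Composition.
Variables (R : realType) (F G : wspecies R).

Definition comp_str (U : finType) : finType :=
  {p : set_partition U &
    (F (pts (val p)) * {dffun forall Q : pts (val p), G (pts (val Q))})%type}.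

Definition comp_weight (U : finType) (x : comp_str U) : R :=
  weight F (tagged x).1 *
    \prod_(Q : pts (val (tag x))) weight G ((tagged x).2 Q).

Section Transport.
Variables (U V : finType) (b : bijection U V).

Definition bij_blocks (p : set_partition U) :
    bijection (pts (val p)) (pts (val (set_partition_image b p))) :=
  bij_restr (b := bij_set b) erefl.

Lemma bij_blocks_inv (p : set_partition U)
    (Q : pts (val (set_partition_image b p))) :
  val Q = b @: val (bij_inv (bij_blocks p) Q).
Proof. by rewrite -[LHS](congr1 val (bij_invK (bij_blocks p) Q)). Qed.

Definition comp_transport (x : comp_str U) : comp_str V :=
  Tagged (fun p : set_partition V =>
      (F (pts (val p)) * {dffun forall Q : pts (val p), G (pts (val Q))})%type)
    (transport F (bij_blocks (tag x)) (tagged x).1,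
     [ffun Q : pts (val (set_partition_image b (tag x))) =>
        transport G (bij_restr (bij_blocks_inv Q))
          ((tagged x).2 (bij_inv (bij_blocks (tag x)) Q))]
     : {dffun forall Q : pts (val (set_partition_image b (tag x))),
          G (pts (val Q))}).
End Transport.

Lemma comp_str_eq (U : finType) (p q : set_partition U)
    (f : F (pts (val p))) (f' : F (pts (val q)))
    (g : {dffun forall Q : pts (val p), G (pts (val Q))})
    (g' : {dffun forall Q : pts (val q), G (pts (val Q))}) :
  val p = val q ->
  (forall c : bijection (pts (val p)) (pts (val q)),
     (forall Q, val (c Q) = val Q) -> transport F c f = f') ->
  (forall (Q : pts (val p)) (Q' : pts (val q))
      (c : bijection (pts (val Q)) (pts (val Q'))), val Q = val Q' ->
     (forall u, val (c u) = val u) -> transport G c (g Q) = g' Q') ->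
  existT _ p (f, g) = existT _ q (f', g') :> comp_str U.
Proof.
move=> /val_inj e; subst q => hf hg.
have -> : f' = f by rewrite -(hf (bij_id _)) // transport_id.
suff -> : g' = g by [].
by apply/ffunP => Q; rewrite -(hg Q Q (bij_id _)) // transport_id.
Qed.

Lemma dffun_block (U : finType) (p : set_partition U)
    (g : {dffun forall Q : pts (val p), G (pts (val Q))}) (Q Q' : pts (val p))
    (V : finType) (c : bijection (pts (val Q)) V)
    (c' : bijection (pts (val Q')) V) :
  Q = Q' -> (forall u u', val u = val u' -> c u = c' u') ->
  transport G c (g Q) = transport G c' (g Q').
Proof. by move=> e; subst Q' => h; apply: eq_transport => u; exact: h. Qed.

Lemma comp_transport_id (U : finType) (x : comp_str U) :
  comp_transport (bij_id U) x = x.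
Proof.
case: x => p [f g]; apply: comp_str_eq => /=.
- rewrite -[RHS]imset_id; apply: eq_imset => A /=; exact: imset_id.
- move=> c hc; rewrite -transport_comp; apply: transport_idE => Q /=.
  by apply: val_inj; apply: (etrans (hc _)); exact: imset_id.
- move=> Q Q' c e hc; rewrite ffunE -transport_comp.
  rewrite -[RHS](transport_id G).
  apply: (@dffun_block U p g (bij_inv (bij_blocks (bij_id U) p) Q) Q').
    by apply: val_inj; rewrite /= imset_id.
  by move=> u u' uu'; apply: val_inj; apply: (etrans (hc _)).
Qed.

Lemma comp_transport_comp (U V W : finType) (b : bijection U V)
    (c : bijection V W) (x : comp_str U) :
  comp_transport (bij_comp b c) x = comp_transport c (comp_transport b x).
Proof.
case: x => p [f g]; apply: comp_str_eq => /=.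
- rewrite -imset_comp; apply: eq_imset => A /=; exact: imset_comp.
- move=> e he; rewrite -!transport_comp; apply: eq_transport => Q /=.
  by apply: val_inj; apply: (etrans (he _)); exact: imset_comp.
- move=> Q Q' e eQ he; rewrite !ffunE -!transport_comp.
  apply: (@dffun_block U p g (bij_inv (bij_blocks (bij_comp b c) p) Q)
    (bij_inv (bij_blocks b p)
       (bij_inv (bij_blocks c (set_partition_image b p)) Q'))).
    by apply: val_inj; rewrite /= eQ -imset_comp.
  by move=> u u' uu'; apply: val_inj; apply: (etrans (he _)); rewrite /= uu'.
Qed.

Lemma comp_weight_transport (U V : finType) (b : bijection U V)
    (x : comp_str U) : comp_weight (comp_transport b x) = comp_weight x.
Proof.
rewrite /comp_weight /= weight_transport; congr (_ * _).
rewrite (reindex (bij_blocks b (tag x))); last first.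
  exists (bij_inv (bij_blocks b (tag x))) => Q _.
    exact: (bij_funK (bij_blocks b (tag x))).
  exact: (bij_invK (bij_blocks b (tag x))).
apply: eq_bigr => Q _; rewrite ffunE weight_transport.
exact: (congr1 (fun Q => weight G ((tagged x).2 Q))
  (bij_funK (bij_blocks b (tag x)) Q)).
Qed.

Lemma comp_weight_ge0 (U : finType) (x : comp_str U) : 0 <= comp_weight x.
Proof.
apply: mulr_ge0; first exact: weight_ge0.
by apply: prodr_ge0 => Q _; exact: weight_ge0.
Qed.

Definition species_comp : wspecies R :=
  WSpecies comp_weight_ge0 comp_transport_id comp_transport_comp
    comp_weight_transport.
End Composition.

Section Unlabelled.
Variables (R : realType) (F : wspecies R).

Definition relabel (k : nat) (x : F 'I_k) (s : {perm 'I_k}) : F 'I_k :=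
  transport F (bij_perm s) x.

Lemma relabel1 (k : nat) (x : F 'I_k) : relabel x 1%g = x.
Proof. by apply: transport_idE => i /=; rewrite perm1. Qed.

Lemma relabelM (k : nat) (x : F 'I_k) (s t : {perm 'I_k}) :
  relabel x (s * t)%g = relabel (relabel x s) t.
Proof.
by rewrite /relabel -transport_comp; apply: eq_transport => i /=; rewrite permM.
Qed.

Definition relabel_action (k : nat) : {action {perm 'I_k} &-> F 'I_k} :=
  TotalAction (@relabel1 k) (@relabelM k).

Definition species_orbit (k : nat) (x : F 'I_k) : {set F 'I_k} :=
  orbit (relabel_action k) [set: {perm 'I_k}] x.

Definition unlabelled_of_size (k : nat) : finType :=
  {O : {set F 'I_k} | O \in @species_orbit k @: [set: F 'I_k]}.

Definition unlabelled : Type := {k : nat & unlabelled_of_size k}.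

Lemma species_orbit_in (k : nat) (x : F 'I_k) :
  species_orbit x \in @species_orbit k @: [set: F 'I_k].
Proof. exact: imset_f. Qed.

Definition unlabelled_orbit (k : nat) (x : F 'I_k) : unlabelled_of_size k :=
  exist (fun O => O \in @species_orbit k @: [set: F 'I_k]) _
    (species_orbit_in x).

(* Structures over a set other than {0, .., k-1} are first transported along an
   arbitrary bijection; the orbit does not depend on it. *)
Definition unlabel (U : finType) (x : F U) : unlabelled :=
  Tagged unlabelled_of_size (unlabelled_orbit (transport F (bij_enum U) x)).

Lemma unlabelled_nonempty (k : nat) (O : unlabelled_of_size k) :
  exists x, x \in val O.
Proof. by case: O => O /= /imsetP[x _ ->]; exists x; exact: orbit_refl. Qed.

(* Only used in quantities that are constant on orbits. *)
Definition representative (k : nat) (O : unlabelled_of_size k) : F 'I_k :=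
  xchoose (unlabelled_nonempty O).

Definition unl_size (O : unlabelled) : nat := tag O.
Definition unl_weight (O : unlabelled) : R :=
  weight F (representative (tagged O)).

Definition ogs (k : nat) : R :=
  \sum_(O : unlabelled_of_size k) unl_weight (Tagged unlabelled_of_size O).

Definition num_cycles (k : nat) (s : {perm 'I_k}) (i : nat) : nat :=
  #|[set C in porbits s | #|C| == i]|.

(* The cycle index series at extended nonnegative arguments: [z i] is the
   value of the variable z_i, for i >= 1; [z 0] is not used. *)
Definition cycle_index (z : nat -> \bar R) : \bar R :=
  (\sum_(0 <= k <oo)
     \sum_(p : F 'I_k * {perm 'I_k} | relabel p.1 p.2 == p.1)
       (weight F p.1 / k`!%:R)%:E *
       \prod_(1 <= i < k.+1) z i ^+ num_cycles p.2 i)%E.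
End Unlabelled.

Section PowerSeries.
Local Open Scope classical_set_scope.
Variable R : realType.

(* Sum, possibly +oo, of a power series with nonnegative coefficients at a
   nonnegative argument. *)
Definition pseries_sum (g : nat -> R) (z : R) : \bar R :=
  (\sum_(0 <= n <oo) (g n * z ^+ n)%:E)%E.

Definition conv_radius (g : nat -> R) : \bar R :=
  ereal_sup [set r%:E | r in [set r : R | 0 <= r /\ cvgn (pseries g r)]].

Definition oo_mod (d : nat) : set_system nat :=
  within [set n : nat | d %| n]%N \oo.

Definition class_S (d : nat) (g : nat -> R) : Prop :=
  exists rho : R, 0 < rho /\ conv_radius g = rho%:E /\
    (forall n, 0 <= g n) /\
    (forall n, ~~ (d %| n)%N -> g n = 0) /\
    g n / g (n + d)%N @[n --> oo_mod d] --> rho ^+ d /\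
    (pseries_sum g rho < +oo)%E /\
    (g n)^-1 * (\sum_(i < n.+1) g i * g (n - i)%N) @[n --> oo_mod d]
      --> 2 * fine (pseries_sum g rho).
End PowerSeries.

Section Remainder.
Variables (R : realType) (F G : wspecies R) (U : finType).
Variables (p : set_partition U) (f : F (pts (val p))).
Variables (g : {dffun forall Q : pts (val p), G (pts (val Q))}).
Variable Q0 : pts (val p).

Let W : finType := pts (~: val Q0).

Definition rem_blocks : {set {set W}} :=
  [set [set w : W | val w \in (Q : {set U})] | Q in val p :\ val Q0].

Lemma block_disjoint (Q : {set U}) (x : U) :
  Q \in val p -> Q != val Q0 -> x \in Q -> x \notin val Q0.
Proof.
move=> Qp QQ0 xQ.
have /and3P[_ /finset.trivIsetP tI _] := valP p.
have := tI _ _ Qp (valP Q0) QQ0.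
by rewrite finset.disjoints_subset => /fintype.subsetP/(_ _ xQ); rewrite inE.
Qed.

Lemma imset_val_trace (Q : {set U}) : Q \in val p -> Q != val Q0 ->
  [set val w | w in [set w : W | val w \in Q]] = Q.
Proof.
move=> Qp QQ0; apply/setP => x; apply/imsetP/idP.
  by case=> w; rewrite inE => wQ ->.
move=> xQ; have xW : x \in ~: val Q0 by rewrite inE; exact: block_disjoint xQ.
by exists (Pts xW); rewrite ?inE.
Qed.

Lemma rem_blocksP : finset.partition rem_blocks [set: W].
Proof.
have /and3P[/eqP cp tI p0] := valP p.
apply/and3P; split.
- apply/eqP/setP => w; rewrite inE; apply/finset.bigcupP.
  have : val w \in finset.cover (val p) by rewrite cp inE.
  case/finset.bigcupP => Q Qp wQ; exists [set w : W | val w \in Q];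
    last by rewrite inE.
  apply: imset_f; rewrite !inE Qp andbT; apply/negP => /eqP QE.
  have wQ0 : val w \in val Q0 := eq_ind Q (fun B => val w \in B) wQ _ QE.
  by have := valP w; rewrite inE wQ0.
- apply/finset.trivIsetP => _ _ /imsetP[A + ->] /imsetP[B + ->].
  rewrite !inE => /andP[_ Ap] /andP[_ Bp] AB.
  have {}AB : A != B by apply: contraNneq AB => ->.
  have /finset.trivIsetP/(_ _ _ Ap Bp AB) := tI.
  rewrite !finset.disjoints_subset => /fintype.subsetP dAB.
  apply/fintype.subsetP => w.
  by rewrite !inE => /dAB; rewrite inE.
- apply/imsetP => -[A]; rewrite !inE => /andP[AQ0 Ap] A0.
  have := imset_val_trace Ap AQ0; rewrite -A0 imset0 => A0'.
  by rewrite A0' Ap in p0.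
Qed.

Definition rem_partition : set_partition W :=
  exist (fun q : {set {set W}} => finset.partition q [set: W]) _ rem_blocksP.

Lemma val_rem_block (Q : pts rem_blocks) :
  val @: val Q \in val p :\ val Q0.
Proof.
case: Q => _ /= /imsetP[A + ->]; rewrite !inE => /andP[AQ0 Ap].
by rewrite imset_val_trace // AQ0.
Qed.

Lemma val_rem_block_in (Q : pts rem_blocks) : val @: val Q \in val p.
Proof. by have := val_rem_block Q; rewrite inE => /andP[]. Qed.

(* The placeholder stands for the deleted block [Q0]; the other blocks are
   seen as subsets of the complement of [Q0]. *)
Definition unrem (o : option (pts rem_blocks)) : pts (val p) :=
  if o is Some Q then Pts (val_rem_block_in Q) else Q0.

Lemma unrem_inj : injective unrem.
Proof.
have valI (A B : {set W}) : val @: A = val @: B -> A = B.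
  by apply: imset_inj; exact: val_inj.
have Q0N (Q : pts rem_blocks) : val @: val Q = val Q0 -> False.
  by move=> e; have := val_rem_block Q; rewrite e !inE eqxx.
move=> [Q|] [Q'|] //= /(congr1 val) /= e.
- by congr Some; apply: val_inj; exact: valI.
- by have := Q0N _ e.
- by have := Q0N _ (esym e).
Qed.

Lemma unrem_surj (Q : pts (val p)) : Q \in codom unrem.
Proof.
have [->|QQ0] := eqVneq Q Q0; first by apply/codomP; exists None.
have QQ0' : val Q != val Q0 by [].
have Qin : [set w : W | val w \in val Q] \in rem_blocks.
  by apply: imset_f; rewrite !inE QQ0' (valP Q).
apply/codomP; exists (Some (Pts Qin)).
by apply: val_inj; rewrite /= imset_val_trace // (valP Q).
Qed.

Definition bij_unrem : bijection (option (pts rem_blocks)) (pts (val p)) :=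
  bij_of_surj unrem_inj unrem_surj.

Section Block.
Variable Q : pts rem_blocks.

Definition block_incl (w : pts (val Q)) : pts (val (unrem (Some Q))) :=
  Pts (imset_f val (valP w)).

Lemma block_incl_inj : injective block_incl.
Proof. by move=> w w' /(congr1 val) /= /val_inj /val_inj. Qed.

Lemma block_incl_surj (x : pts (val (unrem (Some Q)))) : x \in codom block_incl.
Proof.
case: x => x xQ; have /imsetP[w wQ xE] := xQ.
by apply/codomP; exists (Pts wQ); apply: val_inj.
Qed.

Definition bij_block : bijection (pts (val Q)) (pts (val (unrem (Some Q)))) :=
  bij_of_surj block_incl_inj block_incl_surj.
End Block.

Definition remainder_str : species_comp (derived F) G W :=
  Tagged (fun q : set_partition W =>
      (derived F (pts (val q)) *
        {dffun forall Q : pts (val q), G (pts (val Q))})%type)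
    (transport F (bij_sym bij_unrem) f : derived F (pts (val rem_partition)),
     [ffun Q : pts (val rem_partition) =>
        transport G (bij_sym (bij_block Q)) (g (unrem (Some Q)))]
     : {dffun forall Q : pts (val rem_partition), G (pts (val Q))}).
End Remainder.

Section RandomObjects.
Variables (R : realType) (F G : wspecies R).
Local Notation FG := (species_comp F G).
Local Notation F'G := (species_comp (derived F) G).

Definition components (U : finType) (x : FG U) : finType := pts (val (tag x)).

Definition remainder (U : finType) (x : FG U) (Q : components x) :
    unlabelled F'G :=
  unlabel (remainder_str (tagged x).1 (tagged x).2 Q).

Definition max_components (U : finType) (x : FG U) : {set components x} :=
  [set Q : components x | [forall Q' : components x, #|val Q'| <= #|val Q|]%N].

(* Probability that deleting a uniformly chosen component of maximal size
   from (a representative of) [s] leaves [r]. *)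
Definition remainder_prob (s : unlabelled FG) (r : unlabelled F'G) : R :=
  let x := representative (tagged s) in
  #|[set Q in max_components x | remainder Q == r]|%:R / #|max_components x|%:R.
End RandomObjects.

Section Probability.
Local Open Scope classical_set_scope.
Variable R : realType.

(* Random elements of a countable space with its discrete sigma-algebra. *)
Definition random_element (d : measure_display) (Omega : measurableType d)
    (T : Type) (X : Omega -> T) : Prop :=
  forall A : set T, measurable (X @^-1` A).

Definition dTV (d1 d2 : measure_display) (Omega1 : measurableType d1)
    (Omega2 : measurableType d2) (P1 : probability Omega1 R)
    (P2 : probability Omega2 R) (T : Type) (X : Omega1 -> T) (Y : Omega2 -> T) :
    \bar R :=
  ereal_sup [set `|P1 (X @^-1` E) - P2 (Y @^-1` E)|%E | E in [set: set T]].

Variables (F G : wspecies R).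
Variables (d : measure_display) (Omega : measurableType d).
Variable P : probability Omega R.

(* [S] is a random unlabelled object of size [n], with probability
   proportional to the weight. *)
Definition weight_distributed (n : nat) (S : Omega -> unlabelled F) : Prop :=
  random_element S /\
  forall s : unlabelled F, P (S @^-1` [set s]) =
    (if unl_size s == n then unl_weight s / ogs F n else 0)%:E.

Definition boltzmann_distributed (rho : R) (X : Omega -> unlabelled F) : Prop :=
  random_element X /\
  forall s : unlabelled F, P (X @^-1` [set s]) =
    (unl_weight s * rho ^+ unl_size s / fine (pseries_sum (ogs F) rho))%:E.

(* Conditionally on [S], [X] is what remains of [S] after the deletion of a
   uniformly chosen component of maximal size. *)
Definition remainder_of (S : Omega -> unlabelled (species_comp F G))
    (X : Omega -> unlabelled (species_comp (derived F) G)) : Prop :=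
  random_element X /\
  forall s r, P (S @^-1` [set s] `&` X @^-1` [set r]) =
    (P (S @^-1` [set s]) * (remainder_prob s r)%:E)%E.
End Probability.

(* Main.v *)
(** Up to isomorphism, a composite structure is a coloured F-structure: an
    F-structure on the set of components together with a colour, namely an
    unlabelled G-object, for every point. Hence, for n > 2m, the unlabelled
    objects of size n whose largest component leaves a given remainder r of
    size m correspond bijectively to the unlabelled G-objects of size n - m,
    and P(R_n = r) = mu(r) g_(n-m) / h_n exactly, where g and h count the
    weights of the unlabelled objects of G and of the composite species. The
    class S_d gives g_(n-m) / g_n -> rho^m, and if H(rho) denotes the
    normalising constant of R then it remains to see that h_n / g_n -> H(rho):
    pointwise convergence to a probability distribution on a countable space
    implies convergence in total variation.

    The sum of mu(r) g_(n-m) over the remainders of size m <= M divided by g_n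
    tends to the corresponding partial sum of H(rho), so what has to be shown
    is that the objects all of whose components have size < n - M contribute at
    most delta g_n when M is large. By Burnside's lemma, applied to coloured
    structures on {0,..,k-1}, this contribution is bounded by a truncated cycle
    index sum, each term of which is the coefficient of z^n in a product
    (sum_(i < n-M) g_i z^i)^j q(z), where j is the number of fixed points of
    the permutation and q collects the longer cycles. A version of Kesten's
    lemma bounds this coefficient by delta (g(rho) + eps)^j q(rho + eps) g_n,
    uniformly in j and q, and the sum of these bounds is delta g_n times the
    cycle index series assumed to be finite. *)
Require Import Defs.
From mathcomp Require Import all_boot all_order all_algebra all_fingroup.
From mathcomp Require Import all_classical all_reals all_analysis.
From mathcomp Require Import ring lra zify.
Set Implicit Arguments.
Unset Strict Implicit.
Unset Printing Implicit Defensive.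
Import Order.TTheory GRing.Theory Num.Theory.
Import numFieldNormedType.Exports.
Local Open Scope ring_scope.

(** * Isomorphisms of structures *)

Lemma bij_card (U V : finType) (b : bijection U V) : #|U| = #|V|.
Proof. by apply: bij_eq_card; exists (bij_inv b); [exact: bij_funK | exact: bij_invK]. Qed.

Lemma bijection_inj (U V : Type) (b : bijection U V) : injective b.
Proof. exact: can_inj (bij_funK b). Qed.

Lemma prod_bij (R : comRingType) (U V : finType) (b : bijection U V) (E : V -> R) :
  \prod_v E v = \prod_u E (b u).
Proof.
by rewrite (reindex b) //; exists (bij_inv b) => x _; rewrite ?bij_funK ?bij_invK.
Qed.

Lemma sum_bij (U V : finType) (b : bijection U V) (E : V -> nat) :
  (\sum_v E v = \sum_u E (b u))%N.
Proof.
by rewrite (reindex b) //; exists (bij_inv b) => x _; rewrite ?bij_funK ?bij_invK.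
Qed.

Section Isomorphism.
Variables (R : realType) (F : wspecies R).

Lemma transportK (U V : finType) (b : bijection U V) (x : F U) :
  transport F (bij_sym b) (transport F b x) = x.
Proof.
by rewrite -transport_comp; apply: transport_idE => u /=; rewrite bij_funK.
Qed.

Lemma transportKV (U V : finType) (b : bijection U V) (y : F V) :
  transport F b (transport F (bij_sym b) y) = y.
Proof.
by rewrite -transport_comp; apply: transport_idE => u /=; rewrite bij_invK.
Qed.

Definition iso (U V : finType) (x : F U) (y : F V) :=
  exists b : bijection U V, transport F b x = y.

Lemma iso_sym (U V : finType) (x : F U) (y : F V) : iso x y -> iso y x.
Proof. by case=> b <-; exists (bij_sym b); rewrite transportK. Qed.

Lemma iso_trans (U V W : finType) (x : F U) (y : F V) (z : F W) :
  iso x y -> iso y z -> iso x z.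
Proof. by case=> b <- [c <-]; exists (Defs.bij_comp b c); rewrite transport_comp. Qed.

Definition orbit_class (k : nat) (x : F 'I_k) : unlabelled F :=
  Tagged (unlabelled_of_size F) (unlabelled_orbit x).

(** A bijection between ['I_k] and ['I_l] forces [k = l] and is then a permutation, so orbits can be
    handled as isomorphism classes over arbitrary label sets. *)
Lemma orbit_classP (k l : nat) (x : F 'I_k) (y : F 'I_l) :
  orbit_class x = orbit_class y <-> iso x y.
Proof.
split=> [e|[b e]].
  have kl : k = l := congr1 tag e; subst l.
  have /eqP := e; rewrite eq_Tagged => /eqP /(congr1 val) /= exy.
  have : y \in species_orbit x by rewrite exy; exact: orbit_refl.
  by case/orbitP => s _ <-; exists (bij_perm s).
have kl : k = l by have := bij_card b; rewrite !card_ord.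
subst l; congr Tagged; apply: val_inj => /=.
apply/orbit_eqP; rewrite orbit_sym; apply/orbitP.
exists (perm (bijection_inj (b := b))); first by rewrite inE.
by rewrite -e /relabel; apply: eq_transport => i; rewrite /= permE.
Qed.

Lemma unlabelP (U V : finType) (x : F U) (y : F V) :
  unlabel x = unlabel y <-> iso x y.
Proof.
have h (W : finType) (z : F W) : iso z (transport F (bij_enum W) z) by exists (bij_enum W).
split=> [/orbit_classP e|e].
  exact: iso_trans (h _ x) (iso_trans e (iso_sym (h _ y))).
by apply/orbit_classP; exact: iso_trans (iso_sym (h _ x)) (iso_trans e (h _ y)).
Qed.

Lemma orbit_class_repr (O : unlabelled F) :
  orbit_class (representative (tagged O)) = O.
Proof.
case: O => k O; congr Tagged => /=; apply: val_inj => /=.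
have := xchooseP (unlabelled_nonempty O); rewrite -/(representative O).
case: O (representative O) => /= O /imsetP[x _ ->] y yx.
by apply/orbit_eqP.
Qed.

Lemma unlabel_repr (O : unlabelled F) : unlabel (representative (tagged O)) = O.
Proof.
rewrite -[RHS]orbit_class_repr; apply/orbit_classP.
by apply: iso_sym; exists (bij_enum _).
Qed.

Lemma repr_unlabel (U : finType) (x : F U) :
  iso (representative (tagged (unlabel x))) x.
Proof. by apply/unlabelP; exact: unlabel_repr. Qed.

Lemma iso_weight (U V : finType) (x : F U) (y : F V) :
  iso x y -> weight F x = weight F y.
Proof. by case=> b <-; rewrite weight_transport. Qed.

Lemma unl_weight_unlabel (U : finType) (x : F U) :
  unl_weight (unlabel x) = weight F x.
Proof. exact: iso_weight (repr_unlabel x). Qed.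

Lemma unl_size_unlabel (U : finType) (x : F U) : unl_size (unlabel x) = #|U|.
Proof. by []. Qed.

Lemma unl_weight_ge0 (O : unlabelled F) : 0 <= unl_weight O.
Proof. exact: weight_ge0. Qed.

End Isomorphism.

(** * Composite structures as coloured structures *)

Section Blocks.
Variables (U : finType) (p : set_partition U).

Lemma exists_block (u : U) : exists Q : pts (val p), u \in val Q.
Proof.
have /and3P[/eqP cp _ _] := valP p.
have : u \in finset.cover (val p) by rewrite cp inE.
by case/finset.bigcupP => Q Qp uQ; exists (Pts Qp).
Qed.

Lemma block_uniq (Q Q' : pts (val p)) (u : U) :
  u \in val Q -> u \in val Q' -> Q = Q'.
Proof.
move=> uQ uQ'; apply/eqP; apply: contraT => QQ'.
have : u \notin val Q' by apply: (block_disjoint (valP Q) _ uQ).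
by rewrite uQ'.
Qed.

Lemma block_neq0 (Q : pts (val p)) : (0 < #|val Q|)%N.
Proof.
have /and3P[_ _ p0] := valP p; rewrite card_gt0.
by apply: contraNneq p0 => <-; exact: (valP Q).
Qed.

Lemma card_blocks : (\sum_(Q : pts (val p)) #|val Q| = #|U|)%N.
Proof.
rewrite -cardsT (card_partition (valP p)).
by rewrite (big_sub [in val p] (fun A : {set U} => #|A|)).
Qed.

End Blocks.

Section ColouredStructures.
Variables (R : realType) (F G : wspecies R).
Local Notation FG := (species_comp F G).
Local Notation UG := (unlabelled G).

Definition colour (U : finType) (x : comp_str F G U) (Q : pts (val (tag x))) : UG :=
  unlabel ((tagged x).2 Q).

(** Isomorphism of coloured structures. By [comp_isoP] it replaces isomorphism of composites, so
    that set partitions can be forgotten from then on. *)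
Definition ciso (K K' : finType) (f : F K) (c : K -> UG) (f' : F K')
    (c' : K' -> UG) :=
  exists b : bijection K K', transport F b f = f' /\ forall k, c' (b k) = c k.

Lemma ciso_refl (K : finType) (f : F K) (c : K -> UG) : ciso f c f c.
Proof. by exists (bij_id K); rewrite transport_id. Qed.

Lemma ciso_sym (K K' : finType) (f : F K) (c : K -> UG) (f' : F K')
    (c' : K' -> UG) : ciso f c f' c' -> ciso f' c' f c.
Proof.
case=> b [<- h]; exists (bij_sym b); rewrite transportK; split=> // k /=.
by rewrite -h bij_invK.
Qed.

Lemma ciso_trans (K1 K2 K3 : finType) (f1 : F K1) (c1 : K1 -> UG) (f2 : F K2)
    (c2 : K2 -> UG) (f3 : F K3) (c3 : K3 -> UG) :
  ciso f1 c1 f2 c2 -> ciso f2 c2 f3 c3 -> ciso f1 c1 f3 c3.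
Proof.
case=> b [<- h] [b' [<- h']]; exists (Defs.bij_comp b b').
by rewrite transport_comp; split=> // k /=; rewrite h' h.
Qed.

Lemma ciso_colour (K K' : finType) (f : F K) (c : K -> UG) (f' : F K')
    (c' : K' -> UG) : ciso f c f' c' -> forall k', exists k, c' k' = c k.
Proof.
by case=> b [_ h] k'; exists (bij_inv b k'); rewrite -h bij_invK.
Qed.

Lemma size_colour (U : finType) (x : comp_str F G U) (Q : pts (val (tag x))) :
  unl_size (colour Q) = #|val Q|.
Proof. by rewrite unl_size_unlabel card_sig; apply: eq_card => u. Qed.

Lemma iso_ciso (U V : finType) (x : comp_str F G U) (y : comp_str F G V) :
  (exists B, comp_transport B x = y) -> ciso (tagged x).1 (@colour U x) (tagged y).1 (@colour V y).
Proof.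
case=> b <-; exists (bij_blocks b (tag x)); split=> // Q.
rewrite /colour /= ffunE.
have -> : unlabel ((tagged x).2 Q) =
   unlabel ((tagged x).2 (bij_inv (bij_blocks b (tag x)) (bij_blocks b (tag x) Q))).
  by rewrite (bij_funK (bij_blocks b (tag x)) Q).
by apply/unlabelP; apply: iso_sym; eexists; reflexivity.
Qed.

(** A bijection of the classes and independent bijections between matching classes assemble into one
    bijection of the ground sets, because each ground set is the disjoint union of its classes. *)
Lemma glue_blocks (U V : finType) (p : set_partition U) (q : set_partition V)
    (f : F (pts (val p))) (f' : F (pts (val q)))
    (g : {dffun forall Q : pts (val p), G (pts (val Q))})
    (g' : {dffun forall Q : pts (val q), G (pts (val Q))})
    (c : bijection (pts (val p)) (pts (val q))) :
  transport F c f = f' ->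
  (forall Q, exists b : bijection (pts (val Q)) (pts (val (c Q))),
     transport G b (g Q) = g' (c Q)) ->
  exists B : bijection U V,
    comp_transport B (existT _ p (f, g) : comp_str F G U) =
    (existT _ q (f', g') : comp_str F G V).
Proof.
move=> cf hex.
pose b Q := projT1 (cid (hex Q)).
have hb Q : transport G (b Q) (g Q) = g' (c Q) := projT2 (cid (hex Q)).
(* The disjoint union of the classes of [p]; it is identified with [U] by [h1] and, through the
   bijections [b Q], with [V] by [h2]. *)
pose T : finType := {Q : pts (val p) & pts (val Q)}.
pose h1 (t : T) : U := val (tagged t).
pose h2 (t : T) : V := val (b (tag t) (tagged t)).
have h1_inj : injective h1.
  move=> [Q u] [Q' u'] e; rewrite /h1 /= in e.
  have QQ' : Q = Q' by apply: (block_uniq (valP u)); exact: (eq_ind_r (fun w => w \in val Q') (valP u') e).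
  by subst Q'; congr existT; exact: val_inj.
have h2_inj : injective h2.
  move=> [Q u] [Q' u'] e; rewrite /h2 /= in e.
  have cQQ' : c Q = c Q'.
    apply: (block_uniq (valP (b Q u))).
    exact: (eq_ind_r (fun w => w \in val (c Q')) (valP (b Q' u')) e).
  have QQ' := bijection_inj cQQ'.
  subst Q'; congr existT; apply: (bijection_inj (b := b Q)); exact: val_inj.
have h1_surj u : u \in codom h1.
  have [Q uQ] := exists_block p u; apply/codomP.
  by exists (existT _ Q (Pts uQ)).
have h2_surj v : v \in codom h2.
  have [Q' vQ'] := exists_block q v; apply/codomP.
  have [Q eQ] : exists Q, Q' = c Q by exists (bij_inv c Q'); rewrite bij_invK.
  subst Q'; exists (existT _ Q (bij_inv (b Q) (Pts vQ'))).
  by rewrite /h2 /= bij_invK.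
pose B := Defs.bij_comp (bij_sym (bij_of_surj h1_inj h1_surj)) (bij_of_surj h2_inj h2_surj).
have hB (Q : pts (val p)) (u : pts (val Q)) : B (val u) = val (b Q u).
  exact: (congr1 h2 (bij_funK (bij_of_surj h1_inj h1_surj) (existT _ Q u : T))).
have BQ (Q : pts (val p)) : B @: val Q = val (c Q).
  apply/setP => v; apply/imsetP/idP => [[u uQ ->]|vQ].
    by rewrite (hB Q (Pts uQ)); exact: valP.
  exists (val (bij_inv (b Q) (Pts vQ))); first exact: valP.
  by rewrite hB bij_invK.
exists B; apply: comp_str_eq => /=.
- apply/setP => A; apply/imsetP/idP => [[Q Qp ->]|Aq].
    by rewrite (BQ (Pts Qp)); exact: valP.
  exists (val (bij_inv c (Pts Aq))); first exact: valP.
  by rewrite BQ bij_invK.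
- move=> c0 hc0; rewrite -cf -transport_comp; apply: eq_transport => Q /=.
  by apply: val_inj; apply: etrans (hc0 _) _; exact: BQ.
- move=> Q Q' c0 eQ hc0; rewrite ffunE -transport_comp.
  have [Q0 eQ0] : exists Q0, Q' = c Q0 by exists (bij_inv c Q'); rewrite bij_invK.
  subst Q'; rewrite -hb.
  apply: (@dffun_block R G U p g (bij_inv (bij_blocks B p) Q) Q0).
    apply: (bijection_inj (b := bij_blocks B p)); rewrite bij_invK.
    by apply: val_inj; exact: (etrans eQ (esym (BQ Q0))).
  by move=> u u' uu'; apply: val_inj; rewrite -hB -uu'; apply: etrans (hc0 _) _.
Qed.

Lemma ciso_iso (U V : finType) (x : comp_str F G U) (y : comp_str F G V) :
  ciso (tagged x).1 (@colour U x) (tagged y).1 (@colour V y) ->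
  exists B, comp_transport B x = y.
Proof.
intros [c [cf ccol]].
have eta W (z : comp_str F G W) : existT _ (tag z) ((tagged z).1, (tagged z).2) = z.
  by case: z => p [f g].
rewrite -(eta U x) -(eta V y); apply: (glue_blocks cf) => Q.
exact: (proj1 (unlabelP _ _) (esym (ccol Q))).
Qed.

Lemma comp_isoP (U V : finType) (x : comp_str F G U) (y : comp_str F G V) :
  @iso R FG U V x y <-> ciso (tagged x).1 (@colour U x) (tagged y).1 (@colour V y).
Proof. by split; [exact: iso_ciso | exact: ciso_iso]. Qed.

Lemma comp_weightE (U : finType) (x : comp_str F G U) :
  comp_weight x = weight F (tagged x).1 * \prod_(Q : pts (val (tag x))) unl_weight (colour Q).
Proof.
exact (congr1 ( *%R _) (eq_bigr _ (fun Q _ => esym (unl_weight_unlabel _)))).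
Qed.

Lemma card_components (U : finType) (x : comp_str F G U) :
  (\sum_(Q : pts (val (tag x))) unl_size (colour Q) = #|U|)%N.
Proof. by rewrite -(card_blocks (tag x)); apply: eq_bigr => Q _; rewrite size_colour. Qed.

Lemma ciso_weight (K K' : finType) (f : F K) (c : K -> UG) (f' : F K')
    (c' : K' -> UG) : ciso f c f' c' ->
  weight F f * \prod_k unl_weight (c k) = weight F f' * \prod_k unl_weight (c' k).
Proof.
case=> b [<- h]; rewrite weight_transport; congr (_ * _).
by rewrite (prod_bij b); apply: eq_bigr => k _; rewrite h.
Qed.

Lemma ciso_size (K K' : finType) (f : F K) (c : K -> UG) (f' : F K')
    (c' : K' -> UG) : ciso f c f' c' ->
  (\sum_k unl_size (c k) = \sum_k unl_size (c' k))%N.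
Proof. by case=> b [_ h]; rewrite (sum_bij b); apply: eq_bigr => k _; rewrite h. Qed.

(** The ground set is the disjoint union of standard sets, one for each point [k] and of the size of
    its colour, with the fibres as classes. Positive sizes make the classes nonempty and
    distinct. *)
Lemma ciso_realize (K : finType) (f : F K) (c : K -> UG) :
  (forall k, 0 < unl_size (c k))%N ->
  exists (U : finType) (x : comp_str F G U), ciso (tagged x).1 (@colour U x) f c.
Proof.
move=> c0.
pose U : finType := {k : K & 'I_(unl_size (c k))}.
pose blk k : {set U} := [set u : U | tag u == k].
have blk_in k : blk k \in [set blk k | k : K] by apply: imset_f.
have inblk k (i : 'I_(unl_size (c k))) : (existT _ k i : U) \in blk k by rewrite inE.
have pP : finset.partition [set blk k | k : K] [set: U].
  apply/and3P; split.
  - apply/eqP/setP => u; rewrite inE; apply/finset.bigcupP.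
    by exists (blk (tag u)); rewrite ?inE.
  - apply/finset.trivIsetP => _ _ /imsetP[k _ ->] /imsetP[l _ ->] kl.
    rewrite finset.disjoints_subset; apply/fintype.subsetP => u; rewrite !inE.
    by move=> /eqP uk; apply: contraNN kl => /eqP ul; rewrite -uk -ul.
  - apply/imsetP => -[k _ e].
    by have := inblk k (Ordinal (c0 k)); rewrite -e inE.
pose p : set_partition U :=
  exist (fun q : {set {set U}} => finset.partition q [set: U]) _ pP.
pose bk k : pts (val p) := Pts (blk_in k).
have bk_inj : injective bk.
  move=> k l /(congr1 val) /= e.
  by have := inblk k (Ordinal (c0 k)); rewrite e inE => /eqP.
have bk_surj Q : Q \in codom bk.
  apply/codomP; case: Q => Q Qp; have /imsetP[k _ e] := Qp.
  by exists k; apply: val_inj.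
pose B := bij_of_surj bk_inj bk_surj.
have blk_tag k (u : pts (blk k)) : tag (val u) = k by have := valP u; rewrite inE => /eqP.
pose bf k (i : 'I_(unl_size (c k))) : pts (blk k) := Pts (inblk k i).
have bf_inj k : injective (bf k).
  by move=> i j /(congr1 val) /= /eqP; rewrite eq_Tagged => /eqP.
have bf_surj k u : u \in codom (bf k).
  apply/codomP; case: u => -[l i] u; have := u; rewrite inE /= => /eqP lk.
  by subst l; exists i; apply: val_inj.
pose bb k := bij_of_surj (bf_inj k) (bf_surj k).
pose g0 k : G (pts (val (bk k))) := transport G (bb k) (representative (tagged (c k))).
have eBQ Q : bk (bij_inv B Q) = Q := bij_invK B Q.
(* A class [Q] equals [bk (bij_inv B Q)] only propositionally, hence the cast along [eBQ]; [hcol]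
   generalises this equality in order to eliminate it. *)
pose g : {dffun forall Q : pts (val p), G (pts (val Q))} :=
  [ffun Q => eq_rect _ (fun Q : pts (val p) => G (pts (val Q)) : Type)
     (g0 (bij_inv B Q)) _ (eBQ Q)].
have hcol Q (e : bk (bij_inv B Q) = Q) :
    unlabel (eq_rect _ (fun Q : pts (val p) => G (pts (val Q)) : Type)
      (g0 (bij_inv B Q)) _ e) = c (bij_inv B Q).
  move: (bij_inv B Q) e => l e; subst Q; rewrite -[RHS]unlabel_repr.
  by apply/unlabelP; apply: iso_sym; exists (bb l).
exists U, (existT _ p (transport F B f, g) : comp_str F G U); apply: ciso_sym.
exists B; split=> // k; change (unlabel (g (B k)) = c k); rewrite ffunE.
by rewrite (hcol (B k) (eBQ (B k))); congr (c _); exact: (bij_funK B k).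
Qed.

End ColouredStructures.

Section ColouredData.
Variables (R : realType) (F G : wspecies R).
Local Notation FG := (species_comp F G).
Local Notation UG := (unlabelled G).

Definition crepr (s : unlabelled FG) : comp_str F G 'I_(unl_size s) :=
  representative (tagged s).

(** The label set [K] is arbitrary: coloured structures describe an unlabelled composite up to
    [ciso], so [K] can be chosen to suit each construction. *)
Definition has_data (s : unlabelled FG) (K : finType) (f : F K) (c : K -> UG) :=
  ciso (tagged (crepr s)).1 (@colour R F G _ (crepr s)) f c.

Lemma has_data_crepr (s : unlabelled FG) :
  has_data s (tagged (crepr s)).1 (@colour R F G _ (crepr s)).
Proof. exact (ciso_refl _ _). Qed.

Lemma has_data_unlabel (U : finType) (x : comp_str F G U) :
  has_data (@unlabel R FG U x) (tagged x).1 (@colour R F G U x).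
Proof. exact (proj1 (comp_isoP _ _) (repr_unlabel _)). Qed.

Lemma has_data_ciso (s : unlabelled FG) (K K' : finType) (f : F K) (c : K -> UG)
    (f' : F K') (c' : K' -> UG) :
  has_data s f c -> ciso f c f' c' -> has_data s f' c'.
Proof. exact: ciso_trans. Qed.

Lemma has_data_inj (s s' : unlabelled FG) (K K' : finType) (f : F K) (c : K -> UG)
    (f' : F K') (c' : K' -> UG) :
  has_data s f c -> has_data s' f' c' -> ciso f c f' c' -> s = s'.
Proof.
move=> h h' e; rewrite -(unlabel_repr s) -(unlabel_repr s'); apply/unlabelP.
exact (proj2 (comp_isoP _ _) (ciso_trans h (ciso_trans e (ciso_sym h')))).
Qed.

Lemma has_data_ex (K : finType) (f : F K) (c : K -> UG) :
  (forall k, 0 < unl_size (c k))%N -> exists s, has_data s f c.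
Proof.
intros c0; destruct (ciso_realize f c0) as [U [x e]]; exists (@unlabel R FG U x).
exact (has_data_ciso (has_data_unlabel x) e).
Qed.

Lemma has_data_weight (s : unlabelled FG) (K : finType) (f : F K) (c : K -> UG) :
  has_data s f c -> unl_weight s = weight F f * \prod_k unl_weight (c k).
Proof.
intros h; exact (etrans (comp_weightE (crepr s)) (ciso_weight h)).
Qed.

Lemma has_data_size (s : unlabelled FG) (K : finType) (f : F K) (c : K -> UG) :
  has_data s f c -> unl_size s = (\sum_k unl_size (c k))%N.
Proof.
intros h; apply: etrans (ciso_size h).
exact (etrans (esym (card_ord _)) (esym (card_components (crepr s)))).
Qed.

Lemma colour_gt0 (s : unlabelled FG) (K : finType) (f : F K) (c : K -> UG) k :
  has_data s f c -> (0 < unl_size (c k))%N.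
Proof.
intros h; destruct (ciso_colour h k) as [Q ->].
exact (eq_ind_r (fun m => 0 < m)%N (block_neq0 Q) (size_colour Q)).
Qed.

End ColouredData.

(** Isomorphisms of [derived F] are those of [F] that fix the placeholder; this lemma recovers the
    underlying bijection of the remaining points. *)
Lemma bij_option_None (K K' : finType) (b : bijection (option K) (option K')) :
  b None = None -> exists e : bijection K K', bij_option e =1 b.
Proof.
move=> bN.
have bS k : exists l, b (Some k) = Some l.
  case e: (b (Some k)) => [l|]; first by exists l.
  by have e' := @bijection_inj _ _ b _ _ (etrans e (esym bN)).
pose h k := projT1 (cid (bS k)).
have hE k : b (Some k) = Some (h k) := projT2 (cid (bS k)).
have h_inj : injective h.
  by move=> k l e; have := hE k; rewrite e -hE => /(@bijection_inj _ _ b)[].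
have h_surj l : l \in codom h.
  apply/codomP; case e: (bij_inv b (Some l)) => [k|].
    by exists k; have := bij_invK b (Some l); rewrite e hE => -[].
  by have := bij_invK b (Some l); rewrite e bN.
by exists (bij_of_surj h_inj h_surj) => -[k|] //=.
Qed.

(** * Coloured data of a remainder *)

Section Remainders.
Variables (R : realType) (F G : wspecies R).
Local Notation FG := (species_comp F G).
Local Notation F'G := (species_comp (derived F) G).
Local Notation UG := (unlabelled G).

(** Filling the placeholder with a component of colour [a] turns a coloured [derived F]-structure
    into a coloured [F]-structure. *)
Definition ext_colour (K : finType) (c : K -> UG) (a : UG) (o : option K) : UG :=
  if o is Some k then c k else a.

End Remainders.

Lemma has_data_mk (R : realType) (F G : wspecies R) (U : finType) (p : set_partition U)
    (f : F (pts (val p))) (g : {dffun forall Q : pts (val p), G (pts (val Q))}) :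
  has_data (@unlabel R (species_comp F G) U (existT _ p (f, g) : comp_str F G U))
    f (fun Q => unlabel (g Q)).
Proof. exact: (has_data_unlabel (existT _ p (f, g) : comp_str F G U)). Qed.

Lemma unlabel_transport (R : realType) (G : wspecies R) (U V : finType)
  (b : bijection U V) (x : G U) : unlabel (transport G b x) = unlabel x.
Proof. by apply/unlabelP; apply: iso_sym; exists b. Qed.

Section Remainders.
Variables (R : realType) (F G : wspecies R).
Local Notation FG := (species_comp F G).
Local Notation F'G := (species_comp (derived F) G).
Local Notation UG := (unlabelled G).



Lemma has_data_remove (U W : finType) (q : set_partition W)
    (root : derived F (pts (proj1_sig q)))
    (h : forall Q : pts (proj1_sig q), G (pts (proj1_sig Q)))
    (p : set_partition U) (f : F (pts (val p)))
    (g : {dffun forall Q : pts (val p), G (pts (val Q))})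
    (b : bijection (option (pts (proj1_sig q))) (pts (val p))) :
  transport F b root = f ->
  (forall Q, unlabel (h Q) = unlabel (g (b (Some Q)))) ->
  exists (K : finType) (f' : derived F K) (c' : K -> UG)
      (b' : bijection (option K) (pts (val p))),
    [/\ has_data (@unlabel R F'G W (existT _ q (root, [ffun Q => h Q]) : comp_str (derived F) G W)) f' c',
      transport F b' f' = f, b' None = b None &
     forall k, unlabel (g (b' (Some k))) = c' k].
Proof.
move=> h1 h2; exists (pts (proj1_sig q)), root, (fun Q => unlabel (h Q)), b.
refine (And4 _ h1 erefl _); last by move=> k; exact: (esym (h2 k)).
have -> : (fun Q => unlabel (h Q)) = (fun Q => unlabel ([ffun Q => h Q] Q)).
  by apply/funext => Q; rewrite ffunE.
exact (@has_data_mk R (derived F) G W q root [ffun Q => h Q]).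
Qed.

Section RemStr.
Variables (U : finType) (p : set_partition U) (f : F (pts (val p))).
Variable g : {dffun forall Q : pts (val p), G (pts (val Q))}.
Variable Q0 : pts (val p).

(** Besides the data of the remainder, this keeps the bijection [b] that puts the placeholder back
    in the position of [Q0]; it is what relates the remainder to the original structure. *)
Lemma remainder_str_data :
  exists (K : finType) (f' : derived F K) (c' : K -> UG)
      (b : bijection (option K) (pts (val p))),
    [/\ has_data (unlabel (remainder_str f g Q0)) f' c', transport F b f' = f, b None = Q0 &
     forall k, unlabel (g (b (Some k))) = c' k].
Proof.
simple refine (@has_data_remove U (pts (~: val Q0)) (rem_partition Q0) _ _ p f g (bij_unrem Q0) _ _).
- exact (transportKV (bij_unrem Q0) f).
- exact (fun Q => unlabel_transport _ _).
Qed.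

End RemStr.
End Remainders.

(** * Gluing a component to a remainder *)

Lemma big_option (T : Type) (idx : T) (op : Monoid.com_law idx) (K : finType)
    (E : option K -> T) :
  \big[op/idx]_o E o = op (E None) (\big[op/idx]_k E (Some k)).
Proof.
rewrite (bigD1 None) //=; congr (op _ _).
rewrite (reindex_omap Some id) /=; last by case.
by apply: eq_bigl => k; rewrite eqxx.
Qed.

Section Argmax.
Variables (T : finType) (sz : T -> nat).
Definition argmaxes : {set T} := [set Q | [forall Q', sz Q' <= sz Q]%N].

Lemma argmaxes_neq0 (Q : T) : argmaxes != finset.set0.
Proof.
have [Q0 _ h] := arg_maxnP sz (erefl : predT Q).
by apply/set0Pn; exists Q0; rewrite inE; apply/forallP => Q'; exact: h.
Qed.

Lemma argmaxes_uniq (Q0 : T) : (forall Q, Q != Q0 -> sz Q < sz Q0)%N ->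
  argmaxes = [set Q0].
Proof.
move=> h; apply/setP => Q; rewrite !inE; apply/forallP/eqP => [hQ|-> Q'].
  by apply/eqP; apply: contraT => /h; rewrite ltnNge hQ.
by have [->//|/h/ltnW] := eqVneq Q' Q0.
Qed.

End Argmax.

Section Gluing.
Variables (R : realType) (F G : wspecies R).
Local Notation FG := (species_comp F G).
Local Notation F'G := (species_comp (derived F) G).
Local Notation UG := (unlabelled G).

(** [s] arises from [r] by inserting a component [a] at the placeholder. As a relation it needs no
    choice of data; [glued_ex] and [glued_uniq] make it a function of [r] and [a]. *)
Definition glued (r : unlabelled F'G) (a : UG) (s : unlabelled FG) :=
  exists (K : finType) (f : derived F K) (c : K -> UG),
    has_data r f c /\ @has_data R F G s (option K) f (ext_colour c a).

Lemma ext_colour_ciso (K K' : finType) (f : derived F K) (c : K -> UG)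
    (f' : derived F K') (c' : K' -> UG) (a : UG) :
  ciso f c f' c' ->
  @ciso R F G (option K) (option K') f (ext_colour c a) f' (ext_colour c' a).
Proof.
case=> b [h1 h2]; exists (bij_option b); split; first exact: h1.
by case=> [k|] //=.
Qed.

Lemma ex_data (H : wspecies R) (r : unlabelled (species_comp H G)) :
  exists (K : finType) (f : H K) (c : K -> UG), has_data r f c.
Proof.
exists (pts (val (tag (crepr r)))), (tagged (crepr r)).1, (@colour R H G _ (crepr r)).
exact (has_data_crepr r).
Qed.

Lemma glued_data (r : unlabelled F'G) (a : UG) (s : unlabelled FG) (K : finType)
    (f : derived F K) (c : K -> UG) :
  has_data r f c -> glued r a s -> @has_data R F G s (option K) f (ext_colour c a).
Proof.
intros h [K' [f' [c' [h1 h2]]]].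
exact (has_data_ciso h2 (ext_colour_ciso a (ciso_trans (ciso_sym h1) h))).
Qed.

Lemma glued_ex (r : unlabelled F'G) (a : UG) : (0 < unl_size a)%N ->
  exists s, glued r a s.
Proof.
move=> a0; have [K [f [c h]]] := ex_data r.
have c0 k : (0 < unl_size (c k))%N := colour_gt0 k h.
have [|s hs] := @has_data_ex R F G (option K) f (ext_colour c a); first by case.
by exists s, K, f, c.
Qed.

Lemma glued_size (r : unlabelled F'G) (a : UG) (s : unlabelled FG) :
  glued r a s -> unl_size s = (unl_size r + unl_size a)%N.
Proof.
case=> K [f [c [h1 h2]]].
by rewrite (has_data_size h2) (has_data_size h1) big_option addnC.
Qed.

Lemma glued_weight (r : unlabelled F'G) (a : UG) (s : unlabelled FG) :
  glued r a s -> unl_weight s = unl_weight r * unl_weight a.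
Proof.
case=> K [f [c [h1 h2]]].
rewrite (has_data_weight h2) (has_data_weight h1) big_option /=.
by rewrite mulrCA mulrC.
Qed.

Lemma colour_le_size (H : wspecies R) (r : unlabelled (species_comp H G))
    (K : finType) (f : H K) (c : K -> UG) k :
  has_data r f c -> (unl_size (c k) <= unl_size r)%N.
Proof. by move=> h; rewrite (has_data_size h) (bigD1 k) //= leq_addr. Qed.

(** An isomorphism between the two extended colourings either fixes the placeholder, and then the
    colours agree, or makes [a] the colour of a component of [r], which is too small for that. *)
Lemma glued_inj (r : unlabelled F'G) (a a' : UG) (s : unlabelled FG) :
  (unl_size r < unl_size a)%N -> glued r a s -> glued r a' s -> a = a'.
Proof.
intros ra [K [f [c [h1 h2]]]] h3.
destruct (ciso_trans (ciso_sym h2) (glued_data h1 h3)) as [b [_ hb]].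
have := hb None; case: (b None) => [k|] //= ck.
by move: ra; rewrite -ck ltnNge (colour_le_size k h1).
Qed.

Lemma remainder_data (U : finType) (x : comp_str F G U) (Q : pts (val (tag x))) :
  exists (K : finType) (f' : derived F K) (c' : K -> UG)
      (b : bijection (option K) (pts (val (tag x)))),
    [/\ has_data (@remainder R F G U x Q) f' c', transport F b f' = (tagged x).1,
     b None = Q & forall k, colour (b (Some k)) = c' k].
Proof. exact: (remainder_str_data (tagged x).1 (tagged x).2 Q). Qed.

Lemma remainder_ciso (U : finType) (x : comp_str F G U) (Q : pts (val (tag x))) :
  exists (K : finType) (f : derived F K) (c : K -> UG),
    has_data (@remainder R F G U x Q) f c /\
    @ciso R F G _ (option K) (tagged x).1 (@colour R F G U x) f (ext_colour c (colour Q)).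
Proof.
destruct (remainder_data Q) as [K [f [c [b [h1 h2 h3 h4]]]]].
exists K, f, c; split; first exact h1.
apply: ciso_sym; exists b; split; first exact h2.
by case=> [k|]; [exact: (h4 k) | rewrite h3].
Qed.

Lemma remainder_glued (s : unlabelled FG) (Q : pts (val (tag (crepr s)))) :
  glued (@remainder R F G _ (crepr s) Q) (colour Q) s.
Proof. exact (remainder_ciso Q). Qed.

(** The inserted component exceeds all of [r] in size, so it is the only largest component, and its
    deletion gives [r] back. *)
Lemma ciso_remainder (U : finType) (x : comp_str F G U) (r : unlabelled F'G) (a : UG)
    (K : finType) (f : derived F K) (c : K -> UG) :
  (unl_size r < unl_size a)%N -> has_data r f c ->
  @ciso R F G _ (option K) (tagged x).1 (@colour R F G U x) f (ext_colour c a) ->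
  exists Q0 : pts (val (tag x)), @remainder R F G U x Q0 = r /\
    argmaxes (fun Q : pts (val (tag x)) => #|val Q|) = [set Q0]%SET.
Proof.
move=> ra h1 /ciso_sym e0; destruct e0 as [b [hb1 hb2]].
have sz o : #|val (b o)| = unl_size (ext_colour c a o) by rewrite -hb2 size_colour.
have small (Q : pts (val (tag x))) : Q != b None -> (#|val Q| < #|val (b None)|)%N.
  have [oQ <-] : exists oQ, b oQ = Q by exists (bij_inv b Q); rewrite bij_invK.
  case: oQ => [k _|]; last by rewrite eqxx.
  by rewrite !sz /= (leq_ltn_trans (colour_le_size k h1)).
exists (b None); split; last exact (argmaxes_uniq small).
destruct (remainder_data (b None)) as [K' [f' [c' [b' [h1' h2' h3' h4']]]]].
apply: (has_data_inj h1' h1).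
(* Both [b] and [b'] send the placeholder to the same class, so this comparison fixes the
   placeholder and restricts to an isomorphism of the remainders. *)
pose e := Defs.bij_comp b' (bij_sym b).
have eN : e None = None by rewrite /e /= h3' bij_funK.
have [e' he'] := bij_option_None eN.
exists e'; split.
  have -> : f = transport F (bij_sym b) (transport F b' f') by rewrite h2' -hb1 transportK.
  by rewrite -transport_comp; exact (@eq_transport R F _ _ (bij_option e') e f' he').
move=> k; have := he' (Some k); rewrite /e /= => ek.
have bk : b (Some (e' k)) = b' (Some k) by rewrite ek bij_invK.
by rewrite -h4' -bk hb2.
Qed.

End Gluing.

(** * Summing the remainder probabilities *)

Section UniformProbability.
Variables (R : realType) (T : finType) (V : eqType) (A : {set T}) (h : T -> V).

Definition uniform_prob (v : V) : R :=
  #|[set Q in A | h Q == v]|%:R / #|A|%:R.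

Lemma uniform_prob_neq0 v : uniform_prob v != 0 -> exists2 Q, Q \in A & h Q = v.
Proof.
rewrite /uniform_prob; have [->|[Q]] := set_0Vmem [set Q in A | h Q == v].
  by rewrite cards0 mul0r eqxx.
by rewrite inE => /andP[QA /eqP hQ] _; exists Q.
Qed.

(** Double counting: as [e] is injective, each [Q] of [A] is counted for at most one index. *)
Lemma uniform_prob_sum (I : finType) (e : I -> V) : injective e -> A != finset.set0 ->
  \sum_i uniform_prob (e i) = #|[set Q in A | [exists i, e i == h Q]]|%:R / #|A|%:R.
Proof.
move=> e_inj A0; rewrite -mulr_suml; congr (_ / _); rewrite -natr_sum; congr _%:R.
transitivity (\sum_i \sum_(Q in A | h Q == e i) 1)%N.
  by apply: eq_bigr => i _; rewrite -sum1_card; apply: eq_bigl => Q; rewrite !inE.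
rewrite (exchange_big_dep [in A]) /=; last by move=> i Q _ /andP[].
transitivity (\sum_(Q | (Q \in A) && [exists i, e i == h Q]) 1)%N; last first.
  by rewrite -sum1_card; apply: eq_bigl => Q; rewrite inE.
rewrite [RHS]big_mkcondr /=; apply: eq_bigr => Q QA; rewrite ?QA /=; case: existsP => [[i /eqP ei]|hi].
  rewrite (big_pred1 i) // => j /=; rewrite -ei.
  by apply/eqP/eqP => [/e_inj ->|->].
by rewrite big_pred0 // => i; apply/negP => /eqP e1; apply: hi; exists i; rewrite e1.
Qed.

Lemma uniform_prob_set1 Q : A = [set Q] -> uniform_prob (h Q) = 1.
Proof.
move=> A1; rewrite /uniform_prob (_ : [set Q' in A | _] = A).
  by rewrite A1 cards1 divff.
by apply/setP => Q'; rewrite !inE A1 inE; case: eqP => //= ->; rewrite eqxx.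
Qed.

End UniformProbability.

Lemma sum_inj_support (R : realType) (I J : finType) (phi : I -> J) (E : J -> R) :
  injective phi -> (forall j, E j != 0 -> exists i, phi i = j) ->
  \sum_j E j = \sum_i E (phi i).
Proof.
move=> phi_inj hE; rewrite (bigID [in [set phi i | i : I]]) /=.
rewrite [X in _ + X]big1 ?addr0; first by rewrite big_imset //= => i j _ _; exact: phi_inj.
move=> j /negP jphi; apply: contrapT => /eqP /hE[i ij].
by apply: jphi; apply/imsetP; exists i.
Qed.

Section RemainderSums.
Variables (R : realType) (F G : wspecies R).
Local Notation FG := (species_comp F G).
Local Notation F'G := (species_comp (derived F) G).
Local Notation UG := (unlabelled G).

Definition comps (s : unlabelled FG) : finType := pts (val (tag (crepr s))).
Definition csize (s : unlabelled FG) (Q : comps s) : nat := #|val Q|.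
Definition crem (s : unlabelled FG) (Q : comps s) : unlabelled F'G :=
  @remainder R F G _ (crepr s) Q.
Definition ccol (s : unlabelled FG) (Q : comps s) : UG := colour Q.

Lemma remainder_probE (s : unlabelled FG) (r : unlabelled F'G) :
  remainder_prob s r = uniform_prob R (argmaxes (@csize s)) (@crem s) r.
Proof. reflexivity. Qed.

Lemma crem_glued (s : unlabelled FG) (Q : comps s) : glued (crem Q) (ccol Q) s.
Proof. exact (remainder_glued Q). Qed.

Lemma ccol_size (s : unlabelled FG) (Q : comps s) : unl_size (ccol Q) = csize Q.
Proof. exact (size_colour Q). Qed.

Lemma crem_size (s : unlabelled FG) (Q : comps s) :
  (unl_size (crem Q) + csize Q)%N = unl_size s.
Proof. by rewrite -ccol_size -(glued_size (crem_glued Q)). Qed.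

Lemma glued_argmaxes (r : unlabelled F'G) (a : UG) (s : unlabelled FG) :
  (unl_size r < unl_size a)%N -> glued r a s ->
  exists Q0 : comps s, crem Q0 = r /\ argmaxes (@csize s) = [set Q0]%SET.
Proof.
intros ra [K [f [c [h1 h2]]]]; exact (ciso_remainder ra h1 h2).
Qed.

Lemma comps_inhabited (s : unlabelled FG) : (0 < unl_size s)%N -> exists Q : comps s, true.
Proof.
move=> s0; case: (pickP (fun Q : comps s => true)) => [Q _|h]; first by exists Q.
by move: s0; rewrite (has_data_size (has_data_crepr s)) big_pred0.
Qed.

Lemma remainder_prob_neq0 (s : unlabelled FG) (r : unlabelled F'G) :
  remainder_prob s r != 0 -> exists Q : comps s, crem Q = r.
Proof.
rewrite remainder_probE => h; case: (uniform_prob_neq0 h) => Q _ Qr; exists Q; exact Qr.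
Qed.

Lemma glued_remainder_prob (r : unlabelled F'G) (a : UG) (s : unlabelled FG) :
  (unl_size r < unl_size a)%N -> glued r a s -> remainder_prob s r = 1.
Proof.
move=> ra h; rewrite remainder_probE; case: (glued_argmaxes ra h) => Q0 [<- hQ0].
exact (uniform_prob_set1 R (@crem s) hQ0).
Qed.

Lemma glued_uniq (r : unlabelled F'G) (a : UG) (s s' : unlabelled FG) :
  glued r a s -> glued r a s' -> s = s'.
Proof.
intros [K [f [c [h1 h2]]]] h3.
exact (has_data_inj h2 (glued_data h1 h3) (ciso_refl _ _)).
Qed.

End RemainderSums.

Lemma unlabelled_of_sizeP (R : realType) (H : wspecies R) (n : nat) (s : unlabelled H) :
  unl_size s = n -> exists O : unlabelled_of_size H n, Tagged (unlabelled_of_size H) O = s.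
Proof. by case: s => m O /= <-; exists O. Qed.

Section Ball.
Variables (R : realType) (H : wspecies R) (M : nat).

(** Collecting the objects of size below [M] in one finite type turns sums over them into finite
    sums. *)
Definition ball_elt (p : {m : 'I_M & unlabelled_of_size H m}) : unlabelled H :=
  Tagged (unlabelled_of_size H) (tagged p).

Lemma ball_elt_inj : injective ball_elt.
Proof.
move=> [m O] [m' O'] e.
have mm : m = m' by apply: val_inj; exact: (congr1 tag e).
subst m'; congr existT; move/eqP: e.
by rewrite /ball_elt /= eq_Tagged => /eqP.
Qed.

Lemma ball_eltP (s : unlabelled H) :
  [exists p, ball_elt p == s] = (unl_size s < M)%N.
Proof.
apply/existsP/idP => [[[m O] /eqP <-]|sM]; first exact: (ltn_ord m).
case: s sM => m O sM.
by exists (existT _ (Ordinal (sM : m < M)%N) O).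
Qed.

Lemma ball_sum (V : nmodType) (E : unlabelled H -> V) :
  \sum_p E (ball_elt p) =
  \sum_(m < M) \sum_(O : unlabelled_of_size H m) E (Tagged (unlabelled_of_size H) O).
Proof.
by rewrite (@sig_big_dep _ _ _ _ (fun m : 'I_M => unlabelled_of_size H m) xpredT
  (fun _ => xpredT) (fun m O => E (Tagged (unlabelled_of_size H) O))).
Qed.

End Ball.

Section Decomposition.
Variables (R : realType) (F G : wspecies R).
Local Notation FG := (species_comp F G).
Local Notation F'G := (species_comp (derived F) G).
Local Notation UG := (unlabelled G).
Local Notation mk H := (Tagged (unlabelled_of_size H)).

(** Gluing to [r] is a bijection from the G-objects of size [n - |r|] to the objects that can leave
    [r]. Since [n > 2|r|], the glued component is the unique largest one and the probability of
    leaving [r] is 1. *)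
Lemma sum_remainder_prob (r : unlabelled F'G) (n : nat) : (unl_size r + unl_size r < n)%N ->
  \sum_(O : unlabelled_of_size FG n) unl_weight (mk FG O) * remainder_prob (mk FG O) r =
  unl_weight r * ogs G (n - unl_size r).
Proof.
move=> rn; set m := unl_size r.
have big (a : unlabelled_of_size G (n - m)) : (m < unl_size (mk G a))%N.
  by rewrite /unl_size /= /m; lia.
have hphi (a : unlabelled_of_size G (n - m)) :
    exists O : unlabelled_of_size FG n, glued r (mk G a) (mk FG O).
  have [|s hs] := glued_ex r (a := mk G a); first by have := big a; lia.
  have [|O eO] := @unlabelled_of_sizeP _ _ n s.
    by rewrite (glued_size hs) /= subnKC // /m; lia.
  by exists O; rewrite eO.
pose phi a := projT1 (cid (hphi a)).
have phiP a : glued r (mk G a) (mk FG (phi a)) := projT2 (cid (hphi a)).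
have phi_inj : injective phi.
  move=> a b e; have := phiP b; rewrite -e => /(glued_inj (big a) (phiP a)) /eqP.
  by rewrite eq_Tagged => /eqP.
pose E (O : unlabelled_of_size FG n) := unl_weight (mk FG O) * remainder_prob (mk FG O) r.
(* An object that leaves [r] with positive probability is glued from [r] and the colour of a deleted
   component, hence lies in the image of [phi]. *)
have hE O : E O != 0 -> exists a, phi a = O.
  rewrite mulf_eq0 negb_or => /andP[_ /remainder_prob_neq0[Q Qr]].
  have h := crem_glued Q; rewrite Qr in h.
  have [a ea] : exists a : unlabelled_of_size G (n - m), mk G a = ccol Q.
    apply: unlabelled_of_sizeP.
    exact (esym (etrans (congr1 (subn^~ m) (glued_size h)) (addKn _ _))).
  exists a; have := phiP a; rewrite ea => /(glued_uniq h)/eqP.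
  by rewrite eq_Tagged => /eqP.
apply: (etrans (sum_inj_support phi_inj hE)).
rewrite /ogs big_distrr; apply: eq_bigr => a _.
by rewrite /E (glued_remainder_prob (big a) (phiP a)) mulr1 (glued_weight (phiP a)).
Qed.

(** All largest components have the same size, so the size of the remainder is determined by [s],
    and the probability that it is at most [M] is 0 or 1. *)
Lemma sum_ball_remainder_prob (s : unlabelled FG) (M : nat) : (0 < unl_size s)%N ->
  \sum_p remainder_prob s (@ball_elt R F'G M.+1 p) =
  ([exists Q : comps s, (unl_size s <= csize Q + M)%N] : nat)%:R.
Proof.
move=> s0; have [Q1 _] := comps_inhabited s0.
have A0 := argmaxes_neq0 (@csize R F G s) Q1.
under eq_bigr do rewrite remainder_probE.
rewrite (uniform_prob_sum _ _ (@ball_elt_inj R F'G M.+1) A0).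
have eqP1 (Q : comps s) : [exists i, @ball_elt R F'G M.+1 i == crem Q] = (unl_size s <= csize Q + M)%N.
  by rewrite ball_eltP ltnS -(crem_size Q) addnC leq_add2l.
case: existsP => [[Q hQ]|h].
  rewrite (_ : [set _ in _ | _] = argmaxes (@csize R F G s)).
    by rewrite divff // pnatr_eq0 -lt0n card_gt0.
  apply/setP => Q'; rewrite inE; apply: andb_idr; rewrite inE => /forallP/(_ Q) QQ'.
  by rewrite eqP1 (leq_trans hQ) // leq_add2r.
rewrite (_ : [set _ in _ | _] = finset.set0) ?cards0 ?mul0r //.
apply/setP => Q'; rewrite !inE; apply/negP => /andP[_]; rewrite eqP1 => hQ'.
by apply: h; exists Q'.
Qed.

Definition small_comps (s : unlabelled FG) (t : nat) : bool :=
  [forall Q : comps s, csize Q < t]%N.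

(** The objects are split according to whether deleting a largest component leaves size at most [M].
    Those for which it does are weighted by the remainder probabilities and regrouped by remainder;
    [n > 2M] makes [sum_remainder_prob] applicable to each. *)
Lemma ogs_decomposition (n M : nat) : (M + M < n)%N ->
  ogs FG n = \sum_(m < M.+1) ogs F'G m * ogs G (n - m) +
    \sum_(O : unlabelled_of_size FG n | small_comps (mk FG O) (n - M)) unl_weight (mk FG O).
Proof.
move=> Mn.
have big (O : unlabelled_of_size FG n) :
    unl_weight (mk FG O) * \sum_p remainder_prob (mk FG O) (@ball_elt R F'G M.+1 p) =
    unl_weight (mk FG O) * (~~ small_comps (mk FG O) (n - M) : nat)%:R.
  rewrite sum_ball_remainder_prob; last by change (0 < n)%N; lia.
  congr (_ * _%:R); congr (nat_of_bool _); rewrite /small_comps negb_forall.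
  by apply: eq_existsb => Q; rewrite -leqNgt leq_subLR addnC.
have -> : \sum_(m < M.+1) ogs F'G m * ogs G (n - m) =
    \sum_(O : unlabelled_of_size FG n)
      unl_weight (mk FG O) * \sum_p remainder_prob (mk FG O) (@ball_elt R F'G M.+1 p).
  pose E (r : unlabelled F'G) := \sum_(O : unlabelled_of_size FG n)
    unl_weight (mk FG O) * remainder_prob (mk FG O) r.
  transitivity (\sum_(m < M.+1) \sum_(r : unlabelled_of_size F'G m) E (mk F'G r)).
    apply: eq_bigr => m _; apply: (etrans (mulr_suml _ _ _ _)); apply: eq_bigr => r _.
    have mn : (m + m < n)%N by have := ltn_ord m; clear -Mn; lia.
    exact (esym (@sum_remainder_prob (mk F'G r) n mn)).
  apply: (etrans (esym (@ball_sum R F'G M.+1 _ E))).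
  apply: (etrans (exchange_big _ _ _ _ _ _)); apply: eq_bigr => O _.
  exact (esym (mulr_sumr _ _ _ _)).
under [X in _ = X + _]eq_bigr do rewrite big.
rewrite /ogs [X in _ = _ + X]big_mkcond -big_split; apply: eq_bigr => O _ /=.
by case: (small_comps _ _); rewrite /= ?mulr0 ?mulr1 ?add0r ?addr0.
Qed.

End Decomposition.

(** * A weighted Burnside inequality *)

(** The family [h] meets each orbit at most once, hence an inequality. On the orbit of [h i] every
    element has [|aT| / |orbit|] fixing group elements, so the orbit contributes exactly
    [|aT| w (h i)] on the right. *)
Lemma burnside_le (R : realType) (aT : finGroupType) (X I : finType)
    (to : {action aT &-> X}) (w : X -> R) (P : pred I) (h : I -> X) :
  (forall x, 0 <= w x) -> (forall x a, w (to x a) = w x) ->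
  (forall i j, P i -> P j -> h j \in orbit to [set: aT] (h i) -> i = j) ->
  #|aT|%:R * \sum_(i | P i) w (h i) <= \sum_(a : aT) \sum_(x | to x a == x) w x.
Proof.
move=> w0 winv hP; pose orb x := orbit to [set: aT] x.
have stab x y : y \in orb x -> #|aT|%:R = (#|orb x| * #|[set a | to y a == y]|)%:R :> R.
  move=> yx; have <- : orb y = orb x by apply/orbit_eqP.
  have := card_orbit_stab to [set: aT]%G y; rewrite cardsT => <-.
  congr (_ * _)%:R; apply: eq_card => a; rewrite finset.in_setI finset.in_setT /=.
  by rewrite (sameP astab1P eqP) inE.
rewrite [leRHS](exchange_big_dep xpredT) //= big_distrr /=.
(* The middle term retains only the elements of the chosen orbits: it equals the left-hand side, and
   disjointness of these orbits bounds it by the right-hand side. *)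
apply: le_trans (_ : \sum_(i | P i) \sum_(x in orb (h i)) \sum_(a | to x a == x) w x <= _).
  apply: ler_sum => i Pi.
  have orb0 : #|orb (h i)|%:R != 0 :> R.
    by rewrite pnatr_eq0 -lt0n; apply/card_gt0P; exists (h i); exact: orbit_refl.
  rewrite (eq_bigr (fun=> w (h i) * (#|aT|%:R / #|orb (h i)|%:R))); last first.
    move=> x xi; have -> : w x = w (h i) by have /orbitP[a _ <-] := xi; rewrite winv.
    rewrite sumr_const -[LHS]mulr_natr; congr (_ * _); rewrite (stab _ _ xi) natrM mulrAC.
    by rewrite divff // mul1r; congr (_%:R); apply: eq_card => b; rewrite inE.
  rewrite sumr_const -[leRHS]mulr_natr -mulrA divfK //.
  by rewrite [leRHS]mulrC.
rewrite (exchange_big_dep xpredT) //=; apply: ler_sum => x _.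
rewrite sumr_const -[leLHS]mulr_natr -[leRHS]mulr1 ler_wpM2l ?sumr_ge0 // lern1.
apply/card_le1_eqP => i j /andP[Pi xi] /andP[Pj xj]; apply: hP => //.
have e1 : orbit to [set: aT] x = orbit to [set: aT] (h i) by apply/orbit_eqP.
have e2 : orbit to [set: aT] x = orbit to [set: aT] (h j) by apply/orbit_eqP.
by rewrite -e2 e1; exact: orbit_refl.
Qed.

Section FixedColourings.
Variables (A : comNzRingType) (I T : finType) (s : {perm I}) (v : T -> A).

(** A colouring fixed by [s] is constant on the cycles, that is, a function on the set of cycles;
    the sum over such functions of a product is a product of sums. *)
Lemma sum_fixed_colourings :
  \sum_(c : {ffun I -> T} | [forall i, c (s i) == c i]) \prod_i v (c i) =
  \prod_(C in porbits s) \sum_t v t ^+ #|C|.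
Proof.
pose B : finType := {C | C \in porbits s}.
have po_in i : porbit s i \in porbits s by apply: imset_f.
pose po i : B := exist (fun C => C \in porbits s) _ (po_in i).
pose h (c : {ffun B -> T}) : {ffun I -> T} := [ffun i => c (po i)].
have po_surj (C : B) : exists i, po i = C.
  case: C => C CP; have /imsetP[i _ e] := CP; exists i; exact: val_inj.
have po_eq i : po (s i) = po i.
  by apply: val_inj => /=; have := porbit_perm s 1 i; rewrite expg1.
have card_po (C : B) : #|[pred i | po i == C]| = #|val C|.
  case: C => C CP /=; have /imsetP[j _ e] := CP; apply: eq_card => i; rewrite inE.
  by rewrite -val_eqE /= e eq_porbit_mem.
rewrite (big_sub (porbits s) (fun C => \sum_t v t ^+ #|C|)) bigA_distr_bigA /=.
have h_inj : injective h.
  move=> c c' /ffunP e; apply/ffunP => C; have [i <-] := po_surj C.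
  by have := e i; rewrite !ffunE.
rewrite (eq_bigl [in [set h c | c : {ffun B -> T}]]) => [|c]; last first.
  apply/forallP/imsetP => [hc|[c' _ -> i]]; last by rewrite !ffunE po_eq.
  have cst i j : po i = po j -> c i = c j.
    move=> /(congr1 val) /= e; have : j \in porbit s i by rewrite e porbit_id.
    case/porbitP => n ->; elim: n => [|n IHn]; first by rewrite expg0 perm1.
    by rewrite expgSr permM (eqP (hc _)).
  pose rep (C : B) := projT1 (cid (po_surj C)).
  have repP C : po (rep C) = C := projT2 (cid (po_surj C)).
  exists [ffun C => c (rep C)] => //; apply/ffunP => i; rewrite !ffunE.
  by apply: cst; rewrite repP.
rewrite big_imset /=; last by move=> c c' _ _; exact: h_inj.
apply: eq_bigr => c _; rewrite (partition_big po predT) //=.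
apply: eq_bigr => C _; rewrite (eq_bigr (fun=> v (c C))); last first.
  by move=> i /eqP <-; rewrite ffunE.
by rewrite prodr_const card_po.
Qed.

End FixedColourings.

Lemma choice_on (I : Type) (X : Type) (P : I -> Prop) (Q : I -> X -> Prop) (i0 : I) :
  P i0 -> (forall i, P i -> exists x, Q i x) -> exists h : I -> X, forall i, P i -> Q i (h i).
Proof.
(* The value at [i0] serves as the default outside [P]. *)
move=> P0 hQ; have [x0 _] := hQ i0 P0.
have /choice[h hh] : forall i, exists x, P i -> Q i x.
  by move=> i; have [/hQ[x Qx]|nP] := pselect (P i); [exists x | exists x0].
by exists h.
Qed.

Lemma partition_big_nat (R : realType) (I : finType) (P : pred I) (m : I -> nat)
    (n : nat) (E : I -> R) : (forall i, (m i <= n)%N) ->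
  \sum_(i | P i) E i = \sum_(k < n.+1) \sum_(i | P i && (m i == k)) E i.
Proof.
move=> mn; rewrite (partition_big (fun i => inord (m i) : 'I_n.+1) xpredT) //=.
apply: eq_bigr => k _; apply: eq_bigl => i; congr (_ && _).
by rewrite -val_eqE /= inordK // ltnS.
Qed.

Section ColouredAction.
Variables (R : realType) (F : wspecies R) (k : nat) (T : finType).
Local Notation X := (F 'I_k * {ffun 'I_k -> T})%type.

(** The inverse makes the colour of [i] travel to [s i], in step with the relabelling of the
    structure. *)
Definition recolour (x : X) (s : {perm 'I_k}) : X :=
  (relabel x.1 s, [ffun i => x.2 (s^-1%g i)]).

Lemma recolour1 x : recolour x 1%g = x.
Proof.
case: x => f c; rewrite /recolour relabel1; congr pair.
by apply/ffunP => i; rewrite ffunE invg1 perm1.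
Qed.

Lemma recolourM x s t : recolour x (s * t)%g = recolour (recolour x s) t.
Proof.
case: x => f c; rewrite /recolour relabelM; congr pair.
by apply/ffunP => i; rewrite !ffunE invMg permM.
Qed.

Definition recolour_action : {action {perm 'I_k} &-> X} :=
  TotalAction recolour1 recolourM.

Lemma recolour_fixed (x : X) s : (recolour x s == x) =
  (relabel x.1 s == x.1) && [forall i, x.2 (s i) == x.2 i].
Proof.
case: x => f c; rewrite xpair_eqE; congr (_ && _).
apply/eqP/forallP => [/ffunP e i|e]; first by rewrite -{2}[c]/c -(e (s i)) ffunE permK.
by apply/ffunP => i; rewrite ffunE -(eqP (e _)) permKV.
Qed.

Variables (v : T -> {poly R}) (n : nat).
(** With monomials [w z^size] for [v], the coefficient of [z^n] selects the colourings of total size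
    [n]; it is extracted only after the product, so that the sum over colourings still factorises
    over cycles. *)
Definition coloured_weight (x : X) : R := weight F x.1 * (\prod_i v (x.2 i))`_n.

Lemma coloured_weight_recolour x s : coloured_weight (recolour x s) = coloured_weight x.
Proof.
have e : \prod_i v ((recolour x s).2 i) = \prod_i v (x.2 i).
  rewrite (reindex_inj (@perm_inj _ s)) /=; apply: eq_bigr => i _.
  by rewrite ffunE permK.
by rewrite /coloured_weight e /= weight_transport.
Qed.

Lemma sum_coloured_fixed :
  \sum_(s : {perm 'I_k}) \sum_(x : X | recolour x s == x) coloured_weight x =
  \sum_(p : F 'I_k * {perm 'I_k} | relabel p.1 p.2 == p.1)
    weight F p.1 * (\prod_(C in porbits p.2) \sum_t v t ^+ #|C|)`_n.
Proof.
have hs s : \sum_(x : X | recolour x s == x) coloured_weight x =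
    \sum_(f : F 'I_k | relabel f s == f)
      weight F f * (\prod_(C in porbits s) \sum_t v t ^+ #|C|)`_n.
  transitivity (\sum_(f : F 'I_k | relabel f s == f)
    \sum_(c : {ffun 'I_k -> T} | [forall i, c (s i) == c i]) coloured_weight (f, c)).
    rewrite pair_big_dep; apply: eq_big => [x|[f c] _] //; exact: recolour_fixed.
  by apply: eq_bigr => f _; rewrite -sum_fixed_colourings coef_sum big_distrr.
rewrite (eq_bigr _ (fun s _ => hs s)).
rewrite (exchange_big_dep xpredT) // pair_big_dep.
by apply: eq_big => [[f s]|[f s] _].
Qed.

End ColouredAction.

(** * Objects whose components are all small *)

Section SmallComponents.
Variables (R : realType) (F G : wspecies R).
Local Notation FG := (species_comp F G).
Local Notation UG := (unlabelled G).
Local Notation mk H := (Tagged (unlabelled_of_size H)).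

Definition monomial (O : UG) : {poly R} := unl_weight O *: 'X^(unl_size O).

(* The part of degree < t * i of the series written G^(nu^i)(z^i) in the paper. *)
Definition colour_poly (t i : nat) : {poly R} :=
  \sum_p monomial (@ball_elt R G t p) ^+ i.

Lemma prod_monomial (I : finType) (c : I -> UG) n :
  (\prod_i monomial (c i))`_n =
  \prod_i unl_weight (c i) * (n == \sum_i unl_size (c i))%N%:R.
Proof. by rewrite scaler_prod -expr_sum coefZ coefXn. Qed.

Lemma has_data_ord (s : unlabelled FG) (k t : nat) :
  #|comps s| = k -> small_comps s t ->
  exists x : F 'I_k * {ffun 'I_k -> {m : 'I_t & unlabelled_of_size G m}},
    has_data s x.1 (fun i => ball_elt (x.2 i)).
Proof.
move=> <- /forallP sm.
have hT (Q : comps s) : exists p, @ball_elt R G t p = ccol Q.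
  have : (unl_size (ccol Q) < t)%N by rewrite ccol_size.
  by rewrite -(@ball_eltP R G) => /existsP[p /eqP e]; exists p.
pose p Q := projT1 (cid (hT Q)).
have pE Q : ball_elt (p Q) = ccol Q := projT2 (cid (hT Q)).
exists (transport F (bij_enum (comps s)) (tagged (crepr s)).1, [ffun i => p (enum_val i)]).
apply: (has_data_ciso (has_data_crepr s)); exists (bij_enum (comps s)); split; first by [].
by move=> Q; rewrite /= ffunE enum_rankK pE.
Qed.

Lemma comps_le (s : unlabelled FG) : (#|comps s| <= unl_size s)%N.
Proof.
rewrite (has_data_size (has_data_crepr s)) -sum1_card; apply: leq_sum => Q _.
exact: (colour_gt0 Q (has_data_crepr s)).
Qed.

(** Each object with [k] components, all of size below [t], is given coloured data on ['I_k].
    Distinct objects have non-isomorphic data, hence data in distinct orbits, and [burnside_le]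
    applies. *)
Lemma small_comps_sum_le_k (n t k : nat) :
  \sum_(O : unlabelled_of_size FG n |
     small_comps (mk FG O) t && (#|comps (mk FG O)| == k)) unl_weight (mk FG O) <=
  (k`!%:R)^-1 * \sum_(p : F 'I_k * {perm 'I_k} | relabel p.1 p.2 == p.1)
      weight F p.1 * (\prod_(C in porbits p.2) colour_poly t #|C|)`_n.
Proof.
pose T : finType := {m : 'I_t & unlabelled_of_size G m}.
pose v (p : T) := monomial (@ball_elt R G t p).
rewrite -[X in _ <= _ * X]/(\sum_(p : F 'I_k * {perm 'I_k} | relabel p.1 p.2 == p.1)
      weight F p.1 * (\prod_(C in porbits p.2) \sum_p v p ^+ #|C|)`_n).
rewrite -sum_coloured_fixed.
have w0 x : 0 <= @coloured_weight R F k T v n x.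
  rewrite mulr_ge0 ?weight_ge0 // prod_monomial mulr_ge0 // prodr_ge0 // => i _.
  exact: unl_weight_ge0.
set P := fun O : unlabelled_of_size FG n => small_comps (mk FG O) t && (#|comps (mk FG O)| == k).
have [s0 Ps0|P0] := pickP P; last first.
  rewrite big_pred0 //; apply: mulr_ge0; first by rewrite invr_ge0.
  by apply: sumr_ge0 => s _; apply: sumr_ge0 => x _; exact: w0.
have [h hP] := @choice_on _ (F 'I_k * {ffun 'I_k -> T})%type P
  (fun O x => has_data (mk FG O) x.1 (fun i => @ball_elt R G t (x.2 i))) s0 Ps0
  (fun O PO => has_data_ord (eqP (proj2 (andP PO))) (proj1 (andP PO))).
rewrite -(ler_pM2l (_ : 0 < k`!%:R)) ?ltr0n ?fact_gt0 // mulVKf ?pnatr_eq0 -?lt0n ?fact_gt0 //.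
rewrite (eq_bigr (fun O => coloured_weight v n (h O))); last first.
  move=> O PO; rewrite (has_data_weight (hP O PO)) /coloured_weight; congr (_ * _).
  by rewrite prod_monomial -(has_data_size (hP O PO)) eqxx mulr1.
have -> : k`!%:R = #|{perm 'I_k}|%:R :> R by rewrite card_Sn.
simple refine (@burnside_le R _ _ _ (@recolour_action R F k T)
  (coloured_weight v n) P h w0 _ _).
  exact (coloured_weight_recolour v n).
move=> O O' PO PO' /orbitP[s _ e].
have /eqP : mk FG O = mk FG O'; last by rewrite eq_Tagged => /eqP.
apply: (has_data_inj (hP O PO) (hP O' PO')); exists (bij_perm s).
rewrite -e /=; split=> // i; by rewrite ffunE permK.
Qed.

(** Components are nonempty, so an object of size [n] has at most [n] of them. *)
Lemma small_comps_sum_le (n t : nat) :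
  \sum_(O : unlabelled_of_size FG n | small_comps (mk FG O) t) unl_weight (mk FG O) <=
  \sum_(k < n.+1) (k`!%:R)^-1 * \sum_(p : F 'I_k * {perm 'I_k} | relabel p.1 p.2 == p.1)
      weight F p.1 * (\prod_(C in porbits p.2) colour_poly t #|C|)`_n.
Proof.
rewrite (partition_big_nat _ _ (fun O => comps_le (mk FG O))).
by apply: ler_sum => k _; exact (small_comps_sum_le_k n t k).
Qed.

End SmallComponents.

Local Open Scope classical_set_scope.
Local Open Scope ring_scope.

(** * Subexponential sequences *)

#[local] Instance oo_mod_filter (d : nat) : Filter (oo_mod d).
Proof. exact: within_filter. Qed.

Lemma near_oo_modP (d : nat) (P : nat -> Prop) :
  (\forall n \near oo_mod d, P n) <->
  exists N, forall n, (N <= n)%N -> (d %| n)%N -> P n.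
Proof.
split.
  by case=> N _ h; exists N => n Nn; apply: h.
by case=> N h; exists N => // n Nn /= dn; apply: h.
Qed.

Lemma oo_mod_ge (d N : nat) : \forall n \near oo_mod d, (N <= n)%N.
Proof. by apply/near_oo_modP; exists N. Qed.

Lemma cvg_near_eq (T U : Type) (F : set_system T) (FF : Filter F) (f h : T -> U)
    (l : set_system U) :
  h x @[x --> F] --> l -> (\forall x \near F, h x = f x) -> f @ F --> l.
Proof. by move=> hl hf; apply: cvg_trans hl; exact: near_eq_cvg. Qed.

Lemma oo_mod_subn (d l : nat) :
  (d %| l)%N -> (n - l)%N @[n --> oo_mod d] --> oo_mod d.
Proof.
move=> dl P /near_oo_modP[N h]; apply/near_oo_modP; exists (N + l)%N => n Nn dn.
by apply: h; [lia | rewrite dvdn_sub].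
Qed.

Lemma near_forall_ltn (T : Type) (F : set_system T) (FF : Filter F)
    (P : nat -> T -> Prop) (A : nat) :
  (forall l, (l < A)%N -> \forall x \near F, P l x) ->
  \forall x \near F, forall l, (l < A)%N -> P l x.
Proof.
elim: A => [|A IHA] h; first by near=> x.
have h1 : \forall x \near F, forall l, (l < A)%N -> P l x.
  by apply: IHA => l lA; apply: h; exact: ltnW.
have h2 := h A (ltnSn A).
near=> x => l; rewrite ltnS leq_eqVlt => /orP[/eqP ->|]; first by near: x.
by move: l; near: x.
Unshelve. all: by end_near. Qed.

Section NonnegativePolynomials.
Variable R : realType.
Implicit Types (p q : {poly R}) (r : R).

Definition nneg_poly q := forall i, 0 <= q`_i.

Lemma nneg_coef q i : nneg_poly q -> 0 <= q`_i.
Proof. exact. Qed.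

Lemma nneg_poly1 : nneg_poly 1.
Proof. by move=> i; rewrite coef1 ler0n. Qed.

Lemma nneg_polyM p q : nneg_poly p -> nneg_poly q -> nneg_poly (p * q).
Proof. by move=> p0 q0 i; rewrite coefM sumr_ge0 // => j _; rewrite mulr_ge0. Qed.

Lemma nneg_polyX p j : nneg_poly p -> nneg_poly (p ^+ j).
Proof.
move=> p0; elim: j => [|j IHj]; first exact: nneg_poly1.
by rewrite exprS; exact: nneg_polyM.
Qed.

Lemma nneg_horner q r : nneg_poly q -> 0 <= r -> 0 <= q.[r].
Proof.
move=> q0 r0; rewrite horner_coef sumr_ge0 // => i _.
by rewrite mulr_ge0 ?exprn_ge0 ?nneg_coef.
Qed.

Lemma sum_coef_le_horner q r A : nneg_poly q -> 0 <= r ->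
  \sum_(0 <= l < A) q`_l * r ^+ l <= q.[r].
Proof.
move=> q0 r0; rewrite (@horner_coef_wide _ (A + size q)) ?leq_addl //.
rewrite -(big_mkord xpredT (fun i => q`_i * r ^+ i)).
rewrite [leRHS](@big_cat_nat _ _ _ A) //= ?leq_addr // lerDl sumr_ge0 // => i _.
by rewrite mulr_ge0 ?exprn_ge0 ?nneg_coef.
Qed.

Lemma coef_le_horner q r n : nneg_poly q -> 0 < r ->
  q`_n <= q.[r] * r ^- n.
Proof.
move=> q0 r0; rewrite ler_pdivlMr ?exprn_gt0 //.
apply: le_trans (sum_coef_le_horner n.+1 q0 (ltW r0)).
rewrite big_nat_recr //= lerDr sumr_ge0 // => i _.
by rewrite mulr_ge0 ?exprn_ge0 ?nneg_coef // ltW.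
Qed.

Lemma horner_le_nneg q r r' : nneg_poly q -> 0 <= r -> r <= r' ->
  q.[r] <= q.[r'].
Proof.
move=> q0 r0 rr; rewrite !horner_coef ler_sum // => i _.
by rewrite ler_wpM2l ?nneg_coef // lerXn2r ?nnegrE // (le_trans r0).
Qed.

End NonnegativePolynomials.

Section SubexponentialSequence.
Variables (R : realType) (d : nat) (g : nat -> R) (rho s : R).
Hypothesis rho_gt0 : 0 < rho.
Hypothesis g_ge0 : forall n, 0 <= g n.
Hypothesis g_dvd : forall n, ~~ (d %| n)%N -> g n = 0.
Hypothesis g_ratio : g n / g (n + d)%N @[n --> oo_mod d] --> rho ^+ d.
Hypothesis g_sum : \sum_(0 <= i < n) g i * rho ^+ i @[n --> \oo] --> s.
Hypothesis g_conv : (g n)^-1 * (\sum_(i < n.+1) g i * g (n - i)%N) @[n --> oo_mod d]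
      --> 2 * s.

Lemma subexp_gt0 : \forall n \near oo_mod d, 0 < g n.
Proof.
have : \forall n \near oo_mod d, 0 < g n / g (n + d)%N.
  by apply: (cvgr_gt _ g_ratio); rewrite exprn_gt0.
apply: filterS => n; rewrite lt0r mulf_eq0 negb_or => /andP[/andP[gn _] _].
by rewrite lt0r gn g_ge0.
Qed.

(** The quotient telescopes into quotients at distance [d], each tending to [rho ^+ d]. *)
Lemma subexp_shift (l : nat) : (d %| l)%N ->
  g (n - l)%N / g n @[n --> oo_mod d] --> rho ^+ l.
Proof.
case/dvdnP => j ->; elim: j => [|j IHj].
  rewrite mul0n expr0; apply: cvg_near_eq (cvg_cst (1 : R)) _; near=> n.
  have gn : 0 < g n by near: n; exact: subexp_gt0.
  by rewrite subn0 divff // gt_eqF.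
have dj : (d %| j.+1 * d)%N by rewrite dvdn_mull.
have h := cvg_comp _ _ (oo_mod_subn dj) g_ratio.
have dj' : (d %| j * d)%N by rewrite dvdn_mull.
have pos : \forall n \near oo_mod d, 0 < g (n - j * d)%N.
  exact: (oo_mod_subn dj' subexp_gt0).
have /(_ (oo_mod_filter d)) := cvgM h IHj; rewrite -exprD -mulSn => hh.
apply: cvg_near_eq hh _; near=> n.
have ln : (d + j * d <= n)%N by near: n; exact: oo_mod_ge.
have gn : 0 < g (n - j * d)%N.
  by near: n; exact: pos.
rewrite /= mulSn (_ : (n - (d + j * d) + d = n - j * d)%N); last by lia.
by rewrite mulrA divfK // gt_eqF.
Unshelve. all: by end_near. Qed.

(** The limit is taken term by term; [a] has to vanish off the multiples of [d] because the ratios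
    are controlled only for shifts by such multiples. *)
Lemma subexp_head_gen (a : nat -> R) (A : nat) :
  (forall m, ~~ (d %| m)%N -> a m = 0) ->
  (\sum_(0 <= i < A) a i * g (n - i)%N) / g n @[n --> oo_mod d]
    --> \sum_(0 <= i < A) a i * rho ^+ i.
Proof.
move=> a_dvd; under eq_cvg do rewrite big_distrl/=.
apply: cvg_big => [|i _]; first exact: add_continuous.
have [di|ndi] := boolP (d %| i)%N; last first.
  rewrite (a_dvd i ndi) mul0r; apply: cvg_near_eq (cvg_cst (0 : R)) _.
  by near=> n; rewrite !mul0r.
have hh : a i * (g (n - i)%N / g n) @[n --> oo_mod d] --> a i * rho ^+ i.
  by apply: cvgM; [exact: cvg_cst | exact: subexp_shift].
by apply: cvg_near_eq hh _; near=> n; rewrite /= mulrA.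
Unshelve. all: by end_near. Qed.

Lemma subexp_head (A : nat) :
  (\sum_(0 <= i < A) g i * g (n - i)%N) / g n @[n --> oo_mod d]
    --> \sum_(0 <= i < A) g i * rho ^+ i.
Proof. exact: subexp_head_gen. Qed.

Lemma subexp_sum_le (A : nat) : \sum_(0 <= i < A) g i * rho ^+ i <= s.
Proof.
have nd : nondecreasing_seq (fun n => \sum_(0 <= i < n) g i * rho ^+ i).
  apply/nondecreasing_seqP => n; rewrite big_nat_recr //= lerDl.
  by rewrite mulr_ge0 // exprn_ge0 // ltW.
have := nondecreasing_cvgn_le nd (cvgP _ g_sum) A.
by rewrite (cvg_lim (@Rhausdorff R) g_sum).
Qed.

Lemma subexp_sum_ge0 : 0 <= s.
Proof. by have := subexp_sum_le 0; rewrite big_geq. Qed.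

Lemma convolution_split (n A : nat) : (A + A <= n)%N ->
  \sum_(i < n.+1) g i * g (n - i)%N =
  2 * (\sum_(0 <= i < A) g i * g (n - i)%N)
   + \sum_(A <= i < n.+1 - A) g i * g (n - i)%N.
Proof.
move=> An; rewrite -(big_mkord xpredT (fun i => g i * g (n - i)%N)).
rewrite (@big_cat_nat _ _ _ A) //=; last by lia.
rewrite (@big_cat_nat _ _ _ (n.+1 - A) A) //=; [|lia|lia].
rewrite (_ : \sum_(n.+1 - A <= i < n.+1) _ = \sum_(0 <= i < A) g i * g (n - i)%N).
  by ring.
rewrite -{1}(add0n (n.+1 - A)%N) big_addn big_nat_rev /=.
rewrite (_ : n.+1 - (n.+1 - A) = A)%N; last by lia.
apply: eq_big_nat => i /andP[_ iA]; rewrite mulrC; congr (g _ * g _); lia.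
Qed.

(** Relative to [g n], the whole convolution tends to [2 s], and by symmetry its two ends contribute
    twice a partial sum of [s]. The middle thus tends to twice the tail of [s]; tail and
    approximation error are taken below [e / 4]. *)
Lemma subexp_middle (e : R) : 0 < e -> exists A0, forall A, (A0 <= A)%N ->
  \forall n \near oo_mod d, \sum_(A <= i < n.+1 - A) g i * g (n - i)%N <= e * g n.
Proof.
move=> e0.
have /cvgrPdist_lt/(_ (e / 4)) : \sum_(0 <= i < n) g i * rho ^+ i @[n --> \oo] --> s by [].
case=> [|A0 _ hA]; first by rewrite divr_gt0.
exists A0 => A /hA /= sA.
have : (g n)^-1 * (\sum_(i < n.+1) g i * g (n - i)%N)
     - 2 * ((\sum_(0 <= i < A) g i * g (n - i)%N) / g n) @[n --> oo_mod d]
   --> 2 * s - 2 * (\sum_(0 <= i < A) g i * rho ^+ i).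
  by apply: cvgB => //; apply: cvgM; [exact: cvg_cst | exact: subexp_head].
move=> /cvgrPdist_lt/(_ (e / 4)) /(_ ltac:(by rewrite divr_gt0)) => h.
near=> n.
have gn : 0 < g n by near: n; exact: subexp_gt0.
have An : (A + A <= n)%N by near: n; exact: oo_mod_ge.
have : `|2 * s - 2 * (\sum_(0 <= i < A) g i * rho ^+ i) -
   ((g n)^-1 * (\sum_(i < n.+1) g i * g (n - i)%N)
     - 2 * ((\sum_(0 <= i < A) g i * g (n - i)%N) / g n))| < e / 4.
  by near: n; exact: h.
rewrite (convolution_split An) -ler_pdivrMr //.
set h1 := \sum_(0 <= i < A) _ in sA *.
set h2 := \sum_(0 <= i < A) _; set h3 := \sum_(A <= _ < _) _.
rewrite (_ : _ - 2 * (h2 / g n) = h3 / g n); last first.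
  by field; rewrite gt_eqF.
move: sA; rewrite !ltr_norml => /andP[_ sA] /andP[h4 _].
lra.
Unshelve. all: by end_near. Qed.

Lemma subexp_body (e : R) : 0 < e -> exists A0, forall A, (A0 <= A)%N ->
  \forall n \near oo_mod d, \sum_(0 <= i < n.+1 - A) g i * g (n - i)%N <= (s + e) * g n.
Proof.
move=> e0; have e20 : 0 < e / 2 by rewrite divr_gt0.
have [A0 hA] := subexp_middle e20; exists A0 => A /hA h.
have hh : \forall n \near oo_mod d,
    (\sum_(0 <= i < A) g i * g (n - i)%N) / g n < s + e / 2.
  have := cvgr_lt _ (@subexp_head A); apply.
  by apply: (le_lt_trans (subexp_sum_le A)); rewrite ltrDl.
near=> n.
have gn : 0 < g n by near: n; exact: subexp_gt0.
have An : (A + A <= n)%N by near: n; exact: oo_mod_ge.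
rewrite (@big_cat_nat _ _ _ A) //=; last by lia.
rewrite [e]splitr addrA mulrDl; apply: lerD; last by near: n; exact: h.
rewrite -ler_pdivrMr //; apply: ltW; near: n; exact: hh.
Unshelve. all: by end_near. Qed.

(** For [t] strictly between [rho] and [r], the ratio condition makes [g n * t ^+ n] eventually
    nondecreasing along multiples of [d], while [(t / r) ^+ n] tends to 0. *)
Lemma subexp_geometric (r e : R) : rho < r -> 0 < e ->
  \forall n \near oo_mod d, r ^- n <= e * g n.
Proof.
move=> rr e0.
have [t rt tr] : exists2 t, rho < t & t < r.
  by exists ((rho + r) / 2); rewrite midf_lt.
have t0 : 0 < t := lt_trans rho_gt0 rt.
have r0 : 0 < r := lt_trans t0 tr.
(* For [d = 0] the strict power inequality fails, but then the only multiple of [d] is 0 and the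
   claim is vacuous for [n >= 1]. *)
have : \forall n \near oo_mod d, 0 < g n /\ g n / g (n + d)%N < t ^+ d \/ d = 0%N.
  have [->|d0] := eqVneq d 0%N; first by apply/near_oo_modP; exists 0%N => *; right.
  near=> n; left; split; near: n; first exact: subexp_gt0.
  apply: (cvgr_lt _ g_ratio).
  by rewrite ltrXn2r // ?ltW // -?lt0n ?nnegrE.
case/near_oo_modP => N0 hN.
(* A multiple of [d] that is at least [N0] once [d] is positive. *)
pose N := (d * N0)%N.
have [->|d0] := posnP d.
  by apply/near_oo_modP; exists 1%N => n n0; rewrite dvd0n; case: n n0.
have NN0 : (N0 <= N)%N by rewrite leq_pmull.
have {}hN n : (N0 <= n)%N -> (d %| n)%N -> 0 < g n /\ g n / g (n + d)%N < t ^+ d.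
  by move=> Nn dn; case: (hN n Nn dn) => // e1; rewrite e1 in d0.
have dN : (d %| N)%N by rewrite dvdn_mulr.
have grow j : g N * t ^+ N <= g (N + j * d)%N * t ^+ (N + j * d).
  elim: j => [|j]; first by rewrite mul0n addn0.
  move=> /le_trans; apply.
  have dd : (d %| N + j * d)%N by rewrite dvdn_add // dvdn_mull.
  have Nj : (N0 <= N + j * d)%N by rewrite (leq_trans NN0) // leq_addr.
  have [g1 g2] := hN (N + j * d)%N Nj dd.
  have [g3 _] := hN (N + j * d + d)%N (leq_trans Nj (leq_addr _ _)) (dvdn_add dd (dvdnn d)).
  rewrite mulSnr addnA (exprD t (N + j * d) d) [leRHS]mulrA mulrAC ler_pM2r ?exprn_gt0 // mulrC.
  by rewrite -ler_pdivrMr // ltW.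
have u0 : 0 < g N * t ^+ N.
  by have [g1 _] := hN N NN0 dN; rewrite mulr_gt0 // exprn_gt0.
have tr_lim : (t / r) ^+ n @[n --> \oo] --> (0 : R).
  apply: cvg_expr; rewrite ger0_norm ?divr_ge0 ?ltW //.
  by rewrite ltr_pdivrMr // mul1r.
have [] := cvgr_lt _ tr_lim (e * (g N * t ^+ N)) (mulr_gt0 e0 u0).
move=> N1 _ h1; apply/near_oo_modP; exists (N + N1)%N => n Nn dn.
have /dvdnP[j jn] : (d %| n - N)%N by rewrite dvdn_sub.
have := grow j; rewrite -jn subnKC; last exact: leq_trans (leq_addr _ _) Nn.
have /= := h1 n (leq_trans (leq_addl _ _) Nn); rewrite expr_div_n => h2 h3.
rewrite -(ler_pM2l (exprn_gt0 n t0)) (le_trans (ltW h2)) // [leRHS]mulrCA ler_pM2l //.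
by rewrite [leRHS]mulrC.
Unshelve. all: by end_near. Qed.

(** * Coefficients of products of truncated series *)

Local Notation trunc t := (\poly_(i < t) g i).

Lemma trunc_nneg (t : nat) : nneg_poly (trunc t).
Proof. by move=> i; rewrite coef_poly; case: ifP. Qed.

Lemma trunc_prod_nneg (t j : nat) (q : {poly R}) :
  nneg_poly q -> nneg_poly (trunc t ^+ j * q).
Proof. by move=> q0; apply: nneg_polyM => //; apply: nneg_polyX; exact: trunc_nneg. Qed.

Lemma trunc_horner (t : nat) : (trunc t).[rho] <= s.
Proof.
rewrite horner_poly -(big_mkord xpredT (fun i => g i * rho ^+ i)).
exact: subexp_sum_le.
Qed.

Lemma trunc_prod_horner (t j : nat) (q : {poly R}) (r e : R) :
  nneg_poly q -> rho <= r -> 0 <= e ->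
  (trunc t ^+ j * q).[rho] <= (s + e) ^+ j * q.[r].
Proof.
move=> q0 rr e0; rewrite hornerM horner_exp.
have rho0 := ltW rho_gt0.
have t0 : 0 <= (trunc t).[rho] by apply: nneg_horner => //; exact: trunc_nneg.
apply: ler_pM => //.
- by rewrite exprn_ge0.
- exact: nneg_horner.
- rewrite lerXn2r ?nnegrE //.
    by rewrite addr_ge0 // subexp_sum_ge0.
  by rewrite (le_trans (trunc_horner t)) // lerDl.
- exact: horner_le_nneg.
Qed.

(** The induction step of Kesten's lemma. Where [b] has index at least [A], it is bounded by [B * g]
    and the convolution of [g] with itself gives [s + e]. In the remaining [A] terms the truncated
    series has index [n - l] with [l < A], and [g (n - l)] is at most [2 rho^l g n], which sums to
    [2 b(rho) g n]. *)
Lemma trunc_mul_coef (t n A : nat) (b : {poly R}) (B e : R) :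
  nneg_poly b -> (A <= n)%N -> (d %| n)%N -> 0 <= B ->
  (forall l, (A <= l)%N -> (d %| l)%N -> b`_l <= B * g l) ->
  (forall l, (l < A)%N -> (d %| l)%N -> g (n - l)%N <= 2 * rho ^+ l * g n) ->
  \sum_(0 <= i < n.+1 - A) g i * g (n - i)%N <= (s + e) * g n ->
  (trunc t * b)`_n <= (B * (s + e) + 2 * b.[rho]) * g n.
Proof.
move=> b0 An dn B0 bB gl body.
have tle i : (trunc t)`_i <= g i by rewrite coef_poly; case: ifP.
have t0 i : 0 <= (trunc t)`_i by apply: nneg_coef; exact: trunc_nneg.
have tdvd i : ~~ (d %| i)%N -> (trunc t)`_i = 0.
  by move=> di; rewrite coef_poly g_dvd // if_same.
rewrite coefM -(big_mkord xpredT (fun i => (trunc t)`_i * b`_(n - i))).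
rewrite (@big_cat_nat _ _ _ (n.+1 - A)) ?leq_subr //= mulrDl lerD //.
  rewrite -mulrA; apply: le_trans (ler_wpM2l B0 body); rewrite big_distrr /=.
  apply: ler_sum_nat => i /andP[_ iA].
  have [di|di] := boolP (d %| i)%N; last by rewrite tdvd // g_dvd // !mul0r mulr0.
  rewrite mulrCA ler_pM ?nneg_coef // bB //; first by lia.
  by rewrite dvdn_sub.
rewrite -mulrA mulrC -mulrA mulrC.
apply: le_trans (_ : 2 * g n * \sum_(0 <= l < A) b`_l * rho ^+ l <= _); last first.
  rewrite [leRHS](_ : _ = 2 * g n * b.[rho]); last by ring.
  by rewrite ler_wpM2l ?mulr_ge0 // sum_coef_le_horner // ltW.
rewrite -{1}(add0n (n.+1 - A)%N) big_addn big_nat_rev /=.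
rewrite (_ : n.+1 - (n.+1 - A) = A)%N; last by lia.
rewrite big_distrr /=; apply: ler_sum_nat => l /andP[_ lA].
rewrite (_ : 0 + A - l.+1 + (n.+1 - A) = n - l)%N; last by lia.
rewrite (_ : n - (n - l) = l)%N; last by lia.
have [dl|dl] := boolP (d %| l)%N; last first.
  rewrite tdvd ?mul0r ?mulr_ge0 ?nneg_coef ?exprn_ge0 // ?ltW //.
  by apply: contra dl => dl; rewrite -(dvdn_subr _ dn) //; lia.
rewrite [leRHS](_ : _ = 2 * rho ^+ l * g n * b`_l); last by ring.
by rewrite ler_wpM2r ?nneg_coef // (le_trans (tle _)) // gl.
Qed.

(* Kesten's lemma, with an extra factor [q] of larger radius of convergence. *)
Lemma trunc_prod_coef_le (r e : R) : rho < r -> 0 < e ->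
  exists2 K, 0 <= K & exists A, forall n, (A <= n)%N -> (d %| n)%N ->
  forall t j (q : {poly R}), nneg_poly q ->
  (trunc t ^+ j * q)`_n <= K * (s + e) ^+ j * q.[r] * g n.
Proof.
move=> rr e0; have e20 : 0 < e / 2 by rewrite divr_gt0.
have r0 : 0 < r := lt_trans rho_gt0 rr.
have [A0 body] := subexp_body e20.
have /near_oo_modP[N0 g0] := subexp_gt0.
pose A := maxn A0 N0.
have near_gl : \forall n \near oo_mod d,
    forall l, (l < A)%N -> (d %| l)%N -> g (n - l)%N <= 2 * rho ^+ l * g n.
  apply: near_forall_ltn => l _; have [dl|ndl] := boolP (d %| l)%N; last first.
    by near=> n.
  have hl : \forall n \near oo_mod d, g (n - l)%N / g n < 2 * rho ^+ l.
    have := cvgr_lt _ (subexp_shift dl); apply.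
    by rewrite ltr_pMl ?exprn_gt0 // ltr1n.
  near=> n => _.
  have gn : 0 < g n by near: n; exact: subexp_gt0.
  by rewrite -ler_pdivrMr // ltW //; near: n.
have near_body := body A (leq_maxl _ _).
have near_geo := subexp_geometric rr (@ltr01 R).
have : \forall n \near oo_mod d, [/\
    forall l, (l < A)%N -> (d %| l)%N -> g (n - l)%N <= 2 * rho ^+ l * g n,
    \sum_(0 <= i < n.+1 - A) g i * g (n - i)%N <= (s + e / 2) * g n &
    r ^- n <= 1 * g n].
  by near=> n; split; near: n.
case/near_oo_modP => N1 hN1.
have g0' n : (A <= n)%N -> (d %| n)%N -> 0 < g n.
  by move=> An; apply: g0; rewrite (leq_trans _ An) // leq_maxr.
(* This covers the finitely many [n < N1] for which the asymptotic estimates are not yet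
   available. *)
pose K0 := \sum_(0 <= n < N1) rho ^- n / g n.
have K0n n : (n < N1)%N -> rho ^- n / g n <= K0.
  move=> nN1; rewrite /K0 big_mkord (bigD1 (Ordinal nN1)) //= lerDl sumr_ge0 //.
  by move=> i _; rewrite divr_ge0 // invr_ge0 exprn_ge0 // ltW.
(* The 1 serves the case [j = 0] with [n >= N1]. The middle term gives [K * (e / 2) >= 2], so that
   passing from [s + e / 2] to [s + e] absorbs the additive [2 b(rho)] at each induction step. [K0]
   serves [n < N1]. *)
pose K := 1 + 2 / (e / 2) + K0.
have K00 : 0 <= K0.
  by rewrite sumr_ge0 // => i _; rewrite divr_ge0 // invr_ge0 exprn_ge0 // ltW.
have K_ge0 : 0 <= K by rewrite !addr_ge0 // divr_ge0 // ltW.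
have small n : (A <= n)%N -> (n < N1)%N -> (d %| n)%N -> rho ^- n <= K * g n.
  move=> An nN dn; rewrite -ler_pdivrMr ?g0' // (le_trans (K0n n nN)) //.
  by rewrite lerDr addr_ge0 // divr_ge0 // ltW.
exists K => //; exists A => n An dn t j q q0; move: n An dn.
have Q0 : 0 <= q.[r] by rewrite nneg_horner // ltW.
have s0 := subexp_sum_ge0.
have se0 : 0 <= s + e by rewrite addr_ge0 // ltW.
elim: j => [|j IHj] n An dn.
  rewrite expr0 mul1r mulr1; apply: le_trans (coef_le_horner n q0 r0) _.
  rewrite -mulrA mulrCA ler_wpM2l //.
  have [nN|nN] := ltnP n N1; last first.
    have [_ _ h] := hN1 n nN dn; apply: le_trans h _.
    by rewrite ler_wpM2r // /K -addrA lerDl addr_ge0 // divr_ge0 // ltW.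
  apply: le_trans (small n An nN dn).
  rewrite lef_pV2 ?posrE ?exprn_gt0 // lerXn2r ?nnegrE ?ltW //.
have bn := trunc_prod_nneg t j q0.
have bh := trunc_prod_horner t j q0 (ltW rr) (ltW e0).
(* For [n < N1] induction is avoided: a coefficient is at most the value at [rho] times
   [rho ^- n]. *)
have [nN|nN] := ltnP n N1.
  have b1n := trunc_prod_nneg t j.+1 q0.
  apply: le_trans (coef_le_horner n b1n rho_gt0) _.
  have := trunc_prod_horner t j.+1 q0 (ltW rr) (ltW e0).
  move=> h; apply: le_trans (ler_wpM2r _ h) _.
    by rewrite invr_ge0 exprn_ge0 // ltW.
  rewrite [leRHS](_ : _ = (s + e) ^+ j.+1 * q.[r] * (K * g n)); last by ring.
  by rewrite ler_wpM2l ?mulr_ge0 ?exprn_ge0 // small.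
have [h1 h2 _] := hN1 n nN dn.
rewrite exprS -mulrA.
have B0 : 0 <= K * (s + e) ^+ j * q.[r] by rewrite !mulr_ge0 // exprn_ge0.
apply: le_trans (trunc_mul_coef t bn An dn B0 IHj h1 h2) _.
rewrite ler_wpM2r //.
apply: le_trans (lerD (lexx _) (ler_wpM2l _ bh)) _ => //.
rewrite -subr_ge0 [leRHS](_ : _ = (s + e) ^+ j * q.[r] * (K * (e / 2) - 2)).
  rewrite mulr_ge0 // ?mulr_ge0 ?exprn_ge0 // subr_ge0 -ler_pdivrMr //.
  by rewrite /K addrAC lerDr addr_ge0.
rewrite exprS; by field.
Unshelve. all: by end_near. Qed.

(* One big jump: if every factor is cut off at [t <= n - M], no factor can carry
   all but a bounded part of the total degree [n], and the coefficient is
   negligible with respect to [g n]. *)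
Lemma trunc_prod_small_fixed (r : R) (j : nat) (del : R) : rho < r -> 0 < del ->
  exists M N, forall n, (N <= n)%N -> (d %| n)%N ->
  forall t (q : {poly R}), (t + M <= n)%N -> nneg_poly q ->
  (trunc t ^+ j * q)`_n <= del * q.[r] * g n.
Proof.
move=> rr; have r0 : 0 < r := lt_trans rho_gt0 rr.
have s0 := subexp_sum_ge0.
have s1 : 0 < s + 1 by rewrite ltr_wpDl.
elim: j del => [|j IHj] del del0.
  have /near_oo_modP[N hN] := subexp_geometric rr del0.
  exists 0%N, N => n Nn dn t q _ q0; rewrite expr0 mul1r.
  apply: le_trans (coef_le_horner n q0 r0) _.
  rewrite mulrAC mulrC ler_wpM2r ?hN //; exact: nneg_horner q0 (ltW r0).
have [K K0 [AK hK]] := trunc_prod_coef_le rr (@ltr01 R).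
(* The divisor [s + 1] compensates for the bound [(s + 1) * g n] on the head of the convolution. *)
have [|M [N hN]] := IHj (del / 2 / (s + 1)); first by rewrite !divr_gt0.
(* Chosen so that the middle part, where Kesten's bound [K * (s + 1) ^+ j] is used, costs at most
   [del / 2]; the added 1 keeps the denominator positive. *)
pose e := del / 2 / (K * (s + 1) ^+ j + 1).
have K1 : 0 <= K * (s + 1) ^+ j by rewrite mulr_ge0 // exprn_ge0 // ltW.
have e0 : 0 < e by rewrite !divr_gt0 // ltr_wpDl.
have [A0 mid] := subexp_middle e0.
pose A := maxn A0 AK.
have near_mid := mid A (leq_maxl _ _).
have near_head : \forall n \near oo_mod d,
    (\sum_(0 <= i < A) g i * g (n - i)%N) / g n < s + 1.
  have := cvgr_lt _ (@subexp_head A); apply.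
  by apply: (le_lt_trans (subexp_sum_le A)); rewrite ltrDl.
have : \forall n \near oo_mod d,
    \sum_(0 <= i < A) g i * g (n - i)%N <= (s + 1) * g n /\
    \sum_(A <= i < n.+1 - A) g i * g (n - i)%N <= e * g n.
  near=> n; split; last by near: n.
  have gn : 0 < g n by near: n; exact: subexp_gt0.
  by rewrite -ler_pdivrMr // ltW //; near: n.
case/near_oo_modP => N1 hN1.
(* The extra [A] leaves [t + M <= n - i] for [i < A], as the induction hypothesis requires, and
   makes the top [A] indices exceed the cut-off [t]. *)
exists (M + A)%N, (N1 + N + A + A)%N => n Nn dn t q tn q0.
have N1n : (N1 <= n)%N by clear -Nn; lia.
have AAn : (A + A <= n)%N by clear -Nn; lia.
have [head middle] := hN1 n N1n dn.
have Q0 : 0 <= q.[r] := nneg_horner q0 (ltW r0).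
have tle i : (trunc t)`_i <= g i by rewrite coef_poly; case: ifP.
have t0 i : 0 <= (trunc t)`_i by apply: nneg_coef; exact: trunc_nneg.
have b0 := trunc_prod_nneg t j q0.
have tdvd i : ~~ (d %| i)%N -> (trunc t)`_i = 0.
  by move=> di; rewrite coef_poly g_dvd // if_same.
rewrite exprS -mulrA; set b := trunc t ^+ j * q in b0 *.
rewrite coefM -(big_mkord xpredT (fun i => (trunc t)`_i * b`_(n - i))).
rewrite (@big_cat_nat _ _ _ A) //=; last by clear -AAn; lia.
rewrite (@big_cat_nat _ _ _ (n.+1 - A) A) //=; [|by clear -AAn; lia|exact: leq_subr].
(* The upper end vanishes: there the truncated factor would have to carry a degree of at least
   [t]. *)
rewrite [X in _ + (_ + X)]big_nat [X in _ + (_ + X)]big1 ?addr0; last first.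
  move=> i /andP[iA _]; rewrite coef_poly ifN ?mul0r // -leqNgt; clear -iA tn; lia.
rewrite [del]splitr 2!mulrDl lerD //.
  apply: le_trans (_ : del / 2 / (s + 1) * q.[r] * ((s + 1) * g n) <= _);
    last by rewrite le_eqVlt; apply/orP; left; apply/eqP; field; rewrite gt_eqF.
  have B0 : 0 <= del / 2 / (s + 1) * q.[r] by rewrite mulr_ge0 // !divr_ge0 // ltW.
  apply: le_trans (ler_wpM2l B0 head).
  rewrite big_distrr /=; apply: ler_sum_nat => i /andP[_ iA].
  have [di|di] := boolP (d %| i)%N; last by rewrite tdvd // g_dvd // !mul0r mulr0.
  rewrite mulrCA ler_pM //.
  apply: hN => //; [clear -Nn iA; lia | by rewrite dvdn_sub | clear -tn iA; lia].
apply: le_trans (_ : K * (s + 1) ^+ j * q.[r] * (e * g n) <= _); last first.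
  rewrite [leLHS](_ : _ = e * (K * (s + 1) ^+ j) * (q.[r] * g n)); last by ring.
  rewrite [leRHS](_ : _ = del / 2 * (q.[r] * g n)); last by ring.
  rewrite ler_wpM2r ?mulr_ge0 // /e mulrAC ler_pdivrMr ?ltr_wpDl //.
  by rewrite ler_wpM2l ?divr_ge0 ?ltW // ltrDl.
have B0 : 0 <= K * (s + 1) ^+ j * q.[r] by rewrite mulr_ge0.
apply: le_trans (ler_wpM2l B0 middle).
rewrite big_distrr /=; apply: ler_sum_nat => i /andP[Ai iA].
have [di|di] := boolP (d %| i)%N; last by rewrite tdvd // g_dvd // !mul0r mulr0.
rewrite mulrCA ler_pM //.
apply: hK => //; last by rewrite dvdn_sub.
by rewrite (leq_trans (leq_maxr A0 AK)) // -/A; clear -iA AAn; lia.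
Unshelve. all: by end_near. Qed.

(** Uniformity in [j]: for large [j], Kesten's bound with [e / 2] already wins, since
    [((s + e / 2) / (s + e)) ^+ j] tends to 0; the finitely many other [j] are covered by
    [trunc_prod_small_fixed]. *)
Lemma trunc_prod_small (r e del : R) : rho < r -> 0 < e -> 0 < del ->
  exists M N, forall n, (N <= n)%N -> (d %| n)%N ->
  forall t j (q : {poly R}), (t + M <= n)%N -> nneg_poly q ->
  (trunc t ^+ j * q)`_n <= del * (s + e) ^+ j * q.[r] * g n.
Proof.
move=> rr e0 del0; have r0 : 0 < r := lt_trans rho_gt0 rr.
have e20 : 0 < e / 2 by rewrite divr_gt0.
have s0 := subexp_sum_ge0.
have se2 : 0 < s + e / 2 by rewrite ltr_wpDl.
have se : 0 < s + e by rewrite ltr_wpDl.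
have [K K0 [A hA]] := trunc_prod_coef_le rr e20.
have [J hJ] : exists J, forall j, (J <= j)%N -> K * (s + e / 2) ^+ j <= del * (s + e) ^+ j.
  have lim0 : K * ((s + e / 2) / (s + e)) ^+ n @[n --> \oo] --> K * 0.
    apply: cvgM; first exact: cvg_cst.
    apply: cvg_expr; rewrite ger0_norm ?divr_ge0 ?ltW //.
    by rewrite ltr_pdivrMr // mul1r ltrD2l ltr_pdivrMr // mulr_natr mulr2n ltrDl.
  rewrite mulr0 in lim0.
  have [J _ hJ] := cvgr_lt _ lim0 del del0.
  exists J => j Jj; have /= := ltW (hJ j Jj).
  by rewrite expr_div_n mulrA ler_pdivrMr ?exprn_gt0.
have [M [N hN]] : exists M N, forall j, (j < J)%N ->
    forall n, (N <= n)%N -> (d %| n)%N ->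
    forall t (q : {poly R}), (t + M <= n)%N -> nneg_poly q ->
    (trunc t ^+ j * q)`_n <= del * (s + e) ^+ j * q.[r] * g n.
  clear hJ; elim: J => [|J [M [N IH]]]; first by exists 0%N, 0%N.
  have [|M' [N' h]] := trunc_prod_small_fixed J (del := del * (s + e) ^+ J) rr.
    by rewrite mulr_gt0 // exprn_gt0.
  exists (M + M')%N, (N + N')%N => j; rewrite ltnS leq_eqVlt => /orP[/eqP ->|jJ] n Nn dn t q tn q0.
    by apply: h => //; clear -Nn tn; lia.
  by apply: IH => //; clear -Nn tn; lia.
exists M, (N + A)%N => n Nn dn t j q tn q0.
have [jJ|Jj] := ltnP j J; first by apply: hN => //; clear -Nn tn; lia.
apply: le_trans (hA n (leq_trans (leq_addl _ _) Nn) dn t j q q0) _.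
by rewrite ler_wpM2r // ler_wpM2r ?hJ // nneg_horner // ltW.
Qed.

End SubexponentialSequence.

(** * Structures without a giant component *)

Lemma num_cycles0 (k : nat) (s : {perm 'I_k}) : num_cycles s 0 = 0%N.
Proof.
apply/eqP; rewrite cards_eq0; apply/eqP/setP => C; rewrite !inE.
apply/negP => /andP[/imsetP[i _ ->]]; rewrite cards_eq0 => /eqP e.
by have := porbit_id s i; rewrite e inE.
Qed.

Lemma prod_porbits (A : comNzRingType) (k : nat) (s : {perm 'I_k}) (P : nat -> A) :
  \prod_(C in porbits s) P #|C| = \prod_(1 <= i < k.+1) P i ^+ num_cycles s i.
Proof.
have Ck (C : {set 'I_k}) : (#|C| < k.+1)%N by rewrite ltnS; have := max_card C; rewrite card_ord.
rewrite (partition_big (fun C : {set 'I_k} => Ordinal (Ck C)) xpredT) //=.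
transitivity (\prod_(i < k.+1) P i ^+ num_cycles s i).
  apply: eq_bigr => i _; rewrite /num_cycles -prodr_const.
  apply: eq_big => [C|C /andP[_ /eqP <-]] //.
  by rewrite inE -val_eqE.
rewrite -(big_mkord xpredT (fun i => P i ^+ num_cycles s i)) big_ltn //.
by rewrite num_cycles0 mul1r.
Qed.

Lemma EFin_prod_le (R : realType) (m n : nat) (x : nat -> R) (z : nat -> \bar R)
    (c : nat -> nat) :
  (forall i, (m <= i < n)%N -> 0 <= x i) ->
  (forall i, (m <= i < n)%N -> ((x i)%:E <= z i)%E) ->
  ((\prod_(m <= i < n) x i ^+ c i)%:E <= \prod_(m <= i < n) z i ^+ c i)%E.
Proof.
move=> x0 xz.
suff : 0 <= \prod_(m <= i < n) x i ^+ c i /\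
  ((\prod_(m <= i < n) x i ^+ c i)%:E <= \prod_(m <= i < n) z i ^+ c i)%E by case.
rewrite big_nat [X in (_ <= X)%E]big_nat.
apply: (big_ind2 (fun (a : R) (b : \bar R) => 0 <= a /\ (a%:E <= b)%E)) => //.
  move=> a1 b1 a2 b2 [a10 ab1] [a20 ab2]; split; first exact: mulr_ge0.
  by rewrite EFinM; apply: lee_pmul; rewrite ?lee_fin.
move=> i mn; have xi0 := x0 i mn; have xzi := xz i mn.
elim: (c i) => [|j [j0 IHj]]; first by rewrite expr0 expe0; split.
split; first exact: exprn_ge0.
by rewrite exprS expeS EFinM; apply: lee_pmul; rewrite ?lee_fin // exprn_ge0.
Qed.

Section ColourPolynomials.
Variables (R : realType) (G : wspecies R).

(** [G] and its power share structures and transports, hence isomorphism classes; [phi] matches the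
    classes through representatives. *)
Lemma ogs_pow (i m : nat) :
  ogs (species_pow G i) m =
  \sum_(O : unlabelled_of_size G m) unl_weight (Tagged (unlabelled_of_size G) O) ^+ i.
Proof.
pose H := species_pow G i.
have iso_pow (U V : finType) (x : G U) (y : G V) : @iso R H U V x y <-> iso x y by [].
have wclass (H' : wspecies R) (x : H' 'I_m) : unl_weight (orbit_class x) = weight H' x.
  by apply: iso_weight; apply/orbit_classP; exact: orbit_class_repr.
pose phi (O : unlabelled_of_size G m) : unlabelled_of_size H m :=
  @unlabelled_orbit R H m (representative O).
have phi_inj : injective phi.
  move=> O O' e; have : orbit_class (representative O) = orbit_class (representative O').
    apply/orbit_classP/iso_pow; apply: (proj1 (@orbit_classP R H m m _ _)).
    exact (congr1 (Tagged (unlabelled_of_size H)) e).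
  rewrite (orbit_class_repr (Tagged (unlabelled_of_size G) O)).
  rewrite (orbit_class_repr (Tagged (unlabelled_of_size G) O')).
  by move/eqP; rewrite eq_Tagged => /eqP.
have phi_surj O : exists O', phi O' = O.
  exists (@unlabelled_orbit R G m (representative O)).
  have : @orbit_class R H m (representative (@unlabelled_orbit R G m (representative O))) =
      Tagged (unlabelled_of_size H) O.
    rewrite -[RHS]orbit_class_repr; apply/orbit_classP/iso_pow.
    apply: (proj1 (@orbit_classP R G m m _ _)).
    exact (orbit_class_repr (@orbit_class R G m (representative O))).
  by move/eqP; rewrite eq_Tagged => /eqP.
apply: (etrans (sum_inj_support phi_inj (fun O _ => phi_surj O))).
apply: eq_bigr => O _; exact: (wclass H (representative O)).
Qed.

Lemma ogs_ge0 (H : wspecies R) m : 0 <= ogs H m.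
Proof. by apply: sumr_ge0 => O _; exact: unl_weight_ge0. Qed.

Lemma colour_poly_nneg t i : nneg_poly (colour_poly G t i).
Proof.
move=> j; rewrite coef_sum sumr_ge0 // => p _; apply: nneg_polyX => l.
by rewrite coefZ coefXn mulr_ge0 ?ler0n ?unl_weight_ge0.
Qed.

Lemma colour_poly1 t : colour_poly G t 1 = \poly_(m < t) ogs G m.
Proof.
rewrite /colour_poly (@ball_sum R G t _ (fun O => monomial O ^+ 1)) poly_def.
by apply: eq_bigr => m _; rewrite /ogs scaler_suml; apply: eq_bigr => O _; rewrite expr1.
Qed.

(** The value is a partial sum of a series of nonnegative terms. *)
Lemma colour_poly_horner t i r : 0 <= r ->
  (((colour_poly G t i).[r])%:E <= pseries_sum (ogs (species_pow G i)) (r ^+ i))%E.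
Proof.
move=> r0; rewrite (_ : _.[r] = \sum_(0 <= m < t) ogs (species_pow G i) m * (r ^+ i) ^+ m).
  rewrite -sumEFin; apply: nneseries_lim_ge => m _.
  by rewrite lee_fin mulr_ge0 ?ogs_ge0 // !exprn_ge0.
rewrite big_mkord /colour_poly (@ball_sum R G t _ (fun O => monomial O ^+ i)) horner_sum.
apply: eq_bigr => m _; rewrite horner_sum ogs_pow big_distrl /=.
apply: eq_bigr => O _; rewrite horner_exp hornerZ hornerXn exprMn.
by rewrite -!exprM [(m * i)%N]mulnC.
Qed.

End ColourPolynomials.

Lemma nneg_poly_prod (R : realType) (I : Type) (l : seq I) (P : pred I) (q : I -> {poly R}) :
  (forall i, nneg_poly (q i)) -> nneg_poly (\prod_(i <- l | P i) q i).
Proof.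
move=> q0; apply: (big_ind (@nneg_poly R)) => //; first exact: nneg_poly1.
exact: nneg_polyM.
Qed.

Lemma cycle_index_term_ge0 (R : realType) (F : wspecies R) (z : nat -> \bar R) (k : nat) :
  (forall i, 0 <= z i)%E -> forall p : F 'I_k * {perm 'I_k},
  (0 <= (weight F p.1 / k`!%:R)%:E * \prod_(1 <= i < k.+1) z i ^+ num_cycles p.2 i)%E.
Proof.
move=> z0 p; apply: mule_ge0; first by rewrite lee_fin divr_ge0 ?weight_ge0.
apply: (big_ind (fun x : \bar R => 0 <= x)%E) => [||i _]; [exact: lee01|exact: mule_ge0|].
exact: expe_ge0.
Qed.

Lemma cycle_index_ge0 (R : realType) (F : wspecies R) (z : nat -> \bar R) :
  (forall i, 0 <= z i)%E -> (0 <= cycle_index F z)%E.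
Proof.
move=> z0; apply: nneseries_ge0 => k _ _; apply: sume_ge0 => p _.
exact: cycle_index_term_ge0.
Qed.

Section Negligible.
Variables (R : realType) (F G : wspecies R) (rho eps s : R) (d : nat).
Local Notation FG := (species_comp F G).
Local Notation mk H := (Tagged (unlabelled_of_size H)).
Local Notation g := (ogs G).
Let z (i : nat) : \bar R := if i == 1%N then (s%:E + eps%:E)%E
  else pseries_sum (ogs (species_pow G i)) ((rho + eps) ^+ i).
Hypothesis rho_gt0 : 0 < rho.
Hypothesis eps_gt0 : 0 < eps.
Hypothesis s_ge0 : 0 <= s.

(** The fixed points supply the power of the truncated series, whose value may only be taken up to
    [s + eps]; the longer cycles form [q], which may be evaluated at [rho + eps], beyond the radius
    of convergence of [g]. *)
Lemma porbit_prod_bound (k t : nat) (sg : {perm 'I_k}) : exists j (q : {poly R}),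
  [/\ \prod_(C in porbits sg) colour_poly G t #|C| = (\poly_(i < t) g i) ^+ j * q,
      nneg_poly q &
      (((s + eps) ^+ j * q.[rho + eps])%:E <=
        \prod_(1 <= i < k.+1) z i ^+ num_cycles sg i)%E].
Proof.
have r0 : 0 <= rho + eps by rewrite addr_ge0 // ltW.
(* With [k = 0] there is no factor of index 1 to split off. *)
rewrite prod_porbits; case: k sg => [|k] sg.
  exists 0%N, 1; rewrite !big_geq // !expr0 !mul1r hornerE.
  by split; [by []|exact: nneg_poly1|exact: lexx].
exists (num_cycles sg 1), (\prod_(2 <= i < k.+2) colour_poly G t i ^+ num_cycles sg i).
rewrite big_ltn // colour_poly1; split=> //.
  by apply: nneg_poly_prod => i; apply: nneg_polyX; exact: colour_poly_nneg.
pose x i := if i == 1%N then s + eps else (colour_poly G t i).[rho + eps].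
have -> : (s + eps) ^+ num_cycles sg 1 *
    (\prod_(2 <= i < k.+2) colour_poly G t i ^+ num_cycles sg i).[rho + eps] =
    \prod_(1 <= i < k.+2) x i ^+ num_cycles sg i.
  rewrite [RHS]big_ltn // /x eqxx horner_prod; congr (_ * _).
  by apply: eq_big_nat => i /andP[i1 _]; rewrite ifN ?horner_exp //; case: i i1 => [|[|]].
apply: EFin_prod_le => i /andP[i1 _]; rewrite /x /z; case: eqP => // _.
- by rewrite addr_ge0 // ltW.
- by apply: nneg_horner => //; exact: colour_poly_nneg.
- exact: colour_poly_horner.
Qed.

Lemma cycle_index_arg_ge0 i : (0 <= z i)%E.
Proof.
rewrite /z; case: eqP => _; first by rewrite -EFinD lee_fin addr_ge0 // ltW.
apply: nneseries_ge0 => m _ _; rewrite lee_fin mulr_ge0 ?ogs_ge0 //.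
by rewrite !exprn_ge0 // addr_ge0 // ltW.
Qed.

Hypothesis Z_fin : (cycle_index F z < +oo)%E.

(** Each term of the Burnside sum is at most [a] times the corresponding term of the cycle index
    series, so their sum is at most [a] times its value. *)
Lemma small_comps_le (n t : nat) (a : R) : 0 <= a ->
  (forall j (q : {poly R}), nneg_poly q ->
    ((\poly_(i < t) g i) ^+ j * q)`_n <= a * (s + eps) ^+ j * q.[rho + eps]) ->
  \sum_(O : unlabelled_of_size FG n | small_comps (mk FG O) t) unl_weight (mk FG O)
    <= a * fine (cycle_index F z).
Proof.
move=> a0 ha; apply: le_trans (small_comps_sum_le F G n t) _.
pose u k := (\sum_(p : F 'I_k * {perm 'I_k} | relabel p.1 p.2 == p.1)
       (weight F p.1 / k`!%:R)%:E *
       \prod_(1 <= i < k.+1) z i ^+ num_cycles p.2 i)%E.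
have term0 k := @cycle_index_term_ge0 R F z k cycle_index_arg_ge0.
have u0 k : (0 <= u k)%E by apply: sume_ge0 => p _; exact: term0.
have Zu : cycle_index F z = (\sum_(0 <= k <oo) u k)%E by [].
have Z0 := cycle_index_ge0 F cycle_index_arg_ge0.
rewrite -lee_fin EFinM fineK; last by rewrite ge0_fin_numE.
apply: (@le_trans _ _ (a%:E * \sum_(0 <= k < n.+1) u k)%E); last first.
  apply: lee_pmul => //; first by apply: sume_ge0.
  by rewrite Zu; apply: nneseries_lim_ge.
rewrite big_mkord ge0_sume_distrr; last by move=> k _.
rewrite -sumEFin; apply: lee_sum => k _.
rewrite /u ge0_sume_distrr; last first.
  by move=> p _; exact: term0.
rewrite big_distrr /= -sumEFin; apply: lee_sum => p _.
have [j [q [-> q0 hz]]] := porbit_prod_bound t p.2.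
apply: (@le_trans _ _ ((a * (weight F p.1 / k`!%:R))%:E *
    ((s + eps) ^+ j * q.[rho + eps])%:E)%E); last first.
  rewrite [leRHS]muleA -(EFinM a); apply: lee_pmul => //.
    by rewrite lee_fin mulr_ge0 // divr_ge0 ?weight_ge0.
  rewrite lee_fin mulr_ge0 //; first by rewrite exprn_ge0 // addr_ge0 // ltW.
  by rewrite nneg_horner // addr_ge0 // ltW.
rewrite -EFinM lee_fin.
apply: le_trans (_ : weight F p.1 / k`!%:R *
    (a * (s + eps) ^+ j * q.[rho + eps]) <= _); last first.
  by rewrite le_eqVlt; apply/orP; left; apply/eqP; ring.
rewrite [leLHS]mulrCA [leLHS]mulrA ler_wpM2l ?ha //.
by rewrite divr_ge0 ?weight_ge0.
Qed.

End Negligible.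

(** * Total variation distance *)

Section FiniteProbability.
Variables (R : realType) (d : measure_display) (Omega : measurableType d).
Variables (P : probability Omega R) (T : eqType) (X : Omega -> T).
Hypothesis X_random : random_element X.

Definition pr (A : set Omega) : R := fine (P A).

Lemma prE A : measurable A -> P A = (pr A)%:E.
Proof. by move=> mA; rewrite /pr fineK // fin_num_measure. Qed.

Lemma pr_ge0 A : 0 <= pr A.
Proof. by rewrite fine_ge0. Qed.

Lemma prT : pr setT = 1.
Proof. by rewrite /pr probability_setT. Qed.

Lemma prU A B : measurable A -> measurable B -> A `&` B = set0 ->
  pr (A `|` B) = pr A + pr B.
Proof.
move=> mA mB AB; apply: EFin_inj.
by rewrite EFinD -!prE //; [exact: measureU | exact: measurableU].
Qed.

Lemma pr_le A B : measurable A -> measurable B -> A `<=` B -> pr A <= pr B.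
Proof.
move=> mA mB AB; rewrite -lee_fin -!prE //; apply: le_measure => //; exact/mem_set.
Qed.

Lemma pr_split A B : measurable A -> measurable B ->
  pr A = pr (A `&` B) + pr (A `&` ~` B).
Proof.
move=> mA mB; rewrite -prU; first by rewrite -setIUr setUv setIT.
- exact: measurableI.
- by apply: measurableI => //; exact: measurableC.
- by rewrite setIACA setICr setI0.
Qed.

Lemma pr_seq (B : set Omega) (l : seq T) : measurable B -> uniq l ->
  pr (X @^-1` [set x | x \in l] `&` B) = \sum_(x <- l) pr (X @^-1` [set x] `&` B).
Proof.
move=> mB; elim: l => [_|x l IHl] /=.
  rewrite big_nil (_ : _ `&` _ = set0) /pr ?measure0 //.
  by apply/seteqP; split => // w [].
move=> /andP[xl ul]; rewrite big_cons -IHl // -prU; last first.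
- apply/seteqP; split => // w [[/= wx _] [/= wl _]]; rewrite wx in wl.
  by rewrite wl in xl.
- by apply: measurableI => //; exact: X_random.
- by apply: measurableI => //; exact: X_random.
congr pr; rewrite -setIUl; congr (_ `&` _); apply/seteqP; split => w /=.
  by rewrite inE => /orP[/eqP ->|]; [left|right].
by case=> [->|wl]; rewrite inE ?eqxx // wl orbT.
Qed.

Lemma pr_seqT (l : seq T) : uniq l ->
  pr (X @^-1` [set x | x \in l]) = \sum_(x <- l) pr (X @^-1` [set x]).
Proof.
move=> ul; rewrite -[X in pr X]setIT pr_seq //.
by apply: eq_bigr => x _; rewrite setIT.
Qed.

Lemma pr_mem_seq (E : set T) (l : seq T) : uniq l ->
  pr (X @^-1` (E `&` [set x | x \in l])) =
  \sum_(x <- l) (if `[< E x >] then pr (X @^-1` [set x]) else 0).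
Proof.
move=> ul; rewrite -big_mkcond -big_filter -pr_seqT ?filter_uniq //.
congr (pr (X @^-1` _)); apply/seteqP; split => x /=.
  by case=> Ex xl; rewrite mem_filter xl andbT; exact/asboolP.
by rewrite mem_filter => /andP[/asboolP].
Qed.

End FiniteProbability.

Section TotalVariation.
Variables (R : realType) (d1 d2 : measure_display).
Variables (Omega1 : measurableType d1) (Omega2 : measurableType d2).
Variables (P1 : probability Omega1 R) (P2 : probability Omega2 R).
Variables (T : eqType) (X : Omega1 -> T) (Y : Omega2 -> T).
Hypotheses (X_random : random_element X) (Y_random : random_element Y).

Lemma dTV_ge0 : (0 <= dTV P1 P2 X Y)%E.
Proof.
apply: (le_trans _ (ereal_sup_ubound _)); first exact: (abse_ge0 (P1 (X @^-1` setT) - P2 (Y @^-1` setT))%E).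
by exists setT.
Qed.

(** On [l] the two laws differ by at most the sum of the differences. Off [l], the mass of [Y] is
    one minus its mass on [l], and that of [X] exceeds this by at most the same sum. *)
Lemma dTV_le (l : seq T) : uniq l ->
  (dTV P1 P2 X Y <= (2 * (\sum_(x <- l)
      `|pr P1 (X @^-1` [set x]) - pr P2 (Y @^-1` [set x])|)
    + 2 * (1 - \sum_(x <- l) pr P2 (Y @^-1` [set x])))%:E)%E.
Proof.
move=> ul; apply: ge_ereal_sup => _ [E _ <-].
rewrite !prE; [|exact: Y_random|exact: X_random].
rewrite -EFinB abse_EFin lee_fin.
have mX A : measurable (X @^-1` A) by exact: X_random.
have mY A : measurable (Y @^-1` A) by exact: Y_random.
set L := [set x | x \in l].
have sX := @pr_split _ _ _ P1 (X @^-1` E) (X @^-1` L) (mX _) (mX _).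
have sY := @pr_split _ _ _ P2 (Y @^-1` E) (Y @^-1` L) (mY _) (mY _).
rewrite -preimage_setI pr_mem_seq // in sX; rewrite -preimage_setI pr_mem_seq // in sY.
have tX := @pr_split _ _ _ P1 setT (X @^-1` L) measurableT (mX _).
have tY := @pr_split _ _ _ P2 setT (Y @^-1` L) measurableT (mY _).
rewrite !setTI prT pr_seqT // in tX; rewrite !setTI prT pr_seqT // in tY.
have mXC : measurable (~` (X @^-1` L)) by apply: measurableC; exact: mX.
have mYC : measurable (~` (Y @^-1` L)) by apply: measurableC; exact: mY.
have lX : pr P1 (X @^-1` E `&` ~` (X @^-1` L)) <= pr P1 (~` (X @^-1` L)).
  by apply: pr_le; [exact: measurableI | by [] | exact: subIsetr].
have lY : pr P2 (Y @^-1` E `&` ~` (Y @^-1` L)) <= pr P2 (~` (Y @^-1` L)).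
  by apply: pr_le; [exact: measurableI | by [] | exact: subIsetr].
have gX := pr_ge0 P1 (X @^-1` E `&` ~` (X @^-1` L)).
have gY := pr_ge0 P2 (Y @^-1` E `&` ~` (Y @^-1` L)).
have dE : `|\sum_(x <- l) (if `[< E x >] then pr P1 (X @^-1` [set x]) else 0) -
    \sum_(x <- l) (if `[< E x >] then pr P2 (Y @^-1` [set x]) else 0)| <=
    \sum_(x <- l) `|pr P1 (X @^-1` [set x]) - pr P2 (Y @^-1` [set x])|.
  rewrite -sumrB; apply: le_trans (ler_norm_sum _ _ _) _; apply: ler_sum => x _.
  by case: ifP => // _; rewrite subr0 normr0.
have dT : `|\sum_(x <- l) pr P1 (X @^-1` [set x]) -
    \sum_(x <- l) pr P2 (Y @^-1` [set x])| <=
    \sum_(x <- l) `|pr P1 (X @^-1` [set x]) - pr P2 (Y @^-1` [set x])|.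
  by rewrite -sumrB; apply: ler_norm_sum.
move: dE dT; rewrite !ler_norml => /andP[dE1 dE2] /andP[dT1 dT2].
apply/andP; split; lra.
Qed.

End TotalVariation.

(** * The limit law of the remainder *)

Section Divisibility.
Variables (R : realType) (F G : wspecies R) (d : nat).
Local Notation mk H := (Tagged (unlabelled_of_size H)).
Hypothesis g_dvd : forall n, ~~ (d %| n)%N -> ogs G n = 0.

Lemma unl_weight_dvd (O : unlabelled G) : ~~ (d %| unl_size O)%N -> unl_weight O = 0.
Proof.
case: O => n O /= /g_dvd; rewrite /ogs => /eqP.
rewrite psumr_eq0 => [/allP /(_ O)|O' _]; last exact: unl_weight_ge0.
by rewrite mem_index_enum => /(_ isT) /eqP.
Qed.

(** If the total size is not a multiple of [d], neither is the size of some component, whose weight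
    is therefore 0. *)
Lemma comp_unl_weight_dvd (r : unlabelled (species_comp F G)) :
  ~~ (d %| unl_size r)%N -> unl_weight r = 0.
Proof.
have [K [f [c h]]] := ex_data r.
rewrite (has_data_weight h) (has_data_size h) => ndvd.
have [k ndk] : exists k, ~~ (d %| unl_size (c k))%N.
  apply: contrapT => hk; case/negP: ndvd; apply: dvdn_sum => k _.
  by apply: contraT => ndk; case: hk; exists k.
by rewrite (bigD1 k) //= (unl_weight_dvd ndk) mul0r mulr0.
Qed.

Lemma comp_ogs_dvd m : ~~ (d %| m)%N -> ogs (species_comp F G) m = 0.
Proof.
by move=> dm; apply: big1 => O _; exact: (@comp_unl_weight_dvd (mk (species_comp F G) O)).
Qed.

End Divisibility.

Section Ratio.
Variables (R : realType) (F G : wspecies R) (rho eps s c : R) (d : nat).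
Local Notation FG := (species_comp F G).
Local Notation F'G := (species_comp (derived F) G).
Local Notation g := (ogs G).
Local Notation mk H := (Tagged (unlabelled_of_size H)).
Hypothesis rho_gt0 : 0 < rho.
Hypothesis eps_gt0 : 0 < eps.
Hypothesis g_dvd : forall n, ~~ (d %| n)%N -> g n = 0.
Hypothesis g_ratio : g n / g (n + d)%N @[n --> oo_mod d] --> rho ^+ d.
Hypothesis g_sum : \sum_(0 <= i < n) g i * rho ^+ i @[n --> \oo] --> s.
Hypothesis g_conv : (g n)^-1 * (\sum_(i < n.+1) g i * g (n - i)%N) @[n --> oo_mod d]
      --> 2 * s.
Hypothesis Z_fin : (cycle_index F (fun i => if i == 1%N then s%:E + eps%:E
  else pseries_sum (ogs (species_pow G i)) ((rho + eps) ^+ i)) < +oo)%E.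
Hypothesis c_sum : \sum_(0 <= m < n) ogs F'G m * rho ^+ m @[n --> \oo] --> c.

Let g_ge0 n : 0 <= g n := ogs_ge0 G n.

(** The one-big-jump estimate holds uniformly in [j] and [q], so [small_comps_le] sums it against
    the cycle index series. Dividing [del] by [fine Z + 1] compensates for the value of that series
    and stays valid if it is 0. *)
Lemma small_comps_negligible (del : R) : 0 < del ->
  exists M0, forall M, (M0 <= M)%N -> \forall n \near oo_mod d,
  \sum_(O : unlabelled_of_size FG n | small_comps (mk FG O) (n - M)) unl_weight (mk FG O)
    <= del * g n.
Proof.
move=> del0; have hZ := Z_fin; set Z := cycle_index _ _ in hZ.
have s0 := subexp_sum_ge0 rho_gt0 g_ge0 g_sum.
have Z0 : 0 <= fine Z.
  exact: fine_ge0 (cycle_index_ge0 F (cycle_index_arg_ge0 G rho_gt0 eps_gt0 s0)).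
have Z1 : 0 < fine Z + 1 by rewrite ltr_wpDl.
have rr : rho < rho + eps by rewrite ltrDl.
have [|M0 [N hN]] := trunc_prod_small rho_gt0 g_ge0 g_dvd g_ratio g_sum g_conv rr
  (e := eps) (del := del / (fine Z + 1)) eps_gt0; first by rewrite divr_gt0.
exists M0 => M M0M; apply/near_oo_modP; exists (N + M)%N => n Nn dn.
have nN : (N <= n)%N := leq_trans (leq_addr _ _) Nn.
have tM : (n - M + M0 <= n)%N by clear -Nn M0M; lia.
apply: le_trans (@small_comps_le _ F G rho eps s rho_gt0 eps_gt0 s0 hZ n (n - M)%N
  (del / (fine Z + 1) * g n) _ _) _.
- by rewrite mulr_ge0 // divr_ge0 // ltW.
- move=> j q q0; apply: le_trans (hN n nN dn (n - M)%N j q tM q0) _.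
  by rewrite le_eqVlt; apply/orP; left; apply/eqP; ring.
rewrite mulrAC ler_wpM2r // mulrAC ler_pdivrMr // ler_wpM2l ?lerDl // ltW //.
Qed.

(** In [ogs_decomposition] divided by [g n], the first sum tends to a partial sum of [c] and the
    second is small. The tail of [c], the approximation of the first sum and the second sum each
    cost at most [e / 4]. *)
Lemma ogs_comp_ratio : ogs FG n / g n @[n --> oo_mod d] --> c.
Proof.
apply/cvgrPdist_le => e e0.
have e40 : 0 < e / 4 by rewrite divr_gt0.
have [M0 hM0] := small_comps_negligible e40.
have /cvgrPdist_le/(_ _ e40)[M1 _ hM1] := c_sum.
pose M := (M0 + M1)%N.
have H_dvd m : ~~ (d %| m)%N -> ogs F'G m = 0 := @comp_ogs_dvd _ (derived F) G d g_dvd m.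
have near_head : \forall n \near oo_mod d,
    `|\sum_(0 <= m < M.+1) ogs F'G m * rho ^+ m -
      (\sum_(0 <= m < M.+1) ogs F'G m * g (n - m)%N) / g n| <= e / 4.
  have /cvgrPdist_le/(_ _ e40) := @subexp_head_gen _ d g rho rho_gt0 g_ge0 g_ratio
    (fun m => ogs F'G m) M.+1 H_dvd.
  exact.
have near_rest := hM0 M (leq_addr _ _).
have near_g := subexp_gt0 rho_gt0 g_ge0 g_ratio.
have cM : `|c - \sum_(0 <= m < M.+1) ogs F'G m * rho ^+ m| <= e / 4.
  by apply: hM1; rewrite /= /M; clear; lia.
near=> n.
have gn : 0 < g n by near: n.
have nM : (M + M < n)%N by near: n; exact: oo_mod_ge.
have h1 : `|\sum_(0 <= m < M.+1) ogs F'G m * rho ^+ m -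
      (\sum_(0 <= m < M.+1) ogs F'G m * g (n - m)%N) / g n| <= e / 4 by near: n.
have h2 : \sum_(O : unlabelled_of_size FG n | small_comps (mk FG O) (n - M))
   unl_weight (mk FG O) <= e / 4 * g n by near: n.
have h3 : 0 <= \sum_(O : unlabelled_of_size FG n | small_comps (mk FG O) (n - M))
   unl_weight (mk FG O) by apply: sumr_ge0 => O _; exact: unl_weight_ge0.
rewrite (ogs_decomposition F G nM) mulrDl.
rewrite -(big_mkord xpredT (fun m => ogs F'G m * g (n - m)%N)).
rewrite -ler_pdivrMr // in h2.
have h4 : 0 <= (\sum_(O : unlabelled_of_size FG n | small_comps (mk FG O) (n - M))
   unl_weight (mk FG O)) / g n by rewrite divr_ge0.
move: cM h1 h2 h4; set a := \sum_(0 <= m < M.+1) _; set b := _ / g n; set r := _ / g n.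
rewrite !ler_norml => /andP[c1 c2] /andP[b1 b2] r1 r2.
apply/andP; split; lra.
Unshelve. all: by end_near. Qed.

End Ratio.

Section RemainderDistribution.
Variables (R : realType) (F G : wspecies R).
Local Notation FG := (species_comp F G).
Local Notation F'G := (species_comp (derived F) G).
Local Notation mk H := (Tagged (unlabelled_of_size H)).
Variables (dS : measure_display) (Omega : measurableType dS) (P : probability Omega R).
Variables (S : Omega -> unlabelled FG) (X : Omega -> unlabelled F'G) (n : nat).
Hypotheses (S_dist : weight_distributed P n S) (X_dist : remainder_of P S X).
Hypothesis h_gt0 : 0 < ogs FG n.

Lemma remainder_pr (r : unlabelled F'G) : (unl_size r + unl_size r < n)%N ->
  pr P (X @^-1` [set r]) = unl_weight r * ogs G (n - unl_size r) / ogs FG n.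
Proof.
move=> rn; have [S_rand S_pr] := S_dist; have [X_rand X_pr] := X_dist.
pose l := [seq mk FG t | t <- enum (unlabelled_of_size FG n)].
have ul : uniq l.
  rewrite map_inj_uniq ?enum_uniq // => O O' /eqP.
  by rewrite eq_Tagged => /eqP.
have mX : measurable (X @^-1` [set r]) by exact: X_rand.
have mS A : measurable (S @^-1` A) by exact: S_rand.
have sz (O : unlabelled_of_size FG n) : unl_size (mk FG O) == n := eqxx n.
have prS (O : unlabelled_of_size FG n) : pr P (S @^-1` [set mk FG O]) = unl_weight (mk FG O) / ogs FG n.
  by rewrite /pr S_pr sz.
(* The list of objects of size [n] carries the full mass of [S], so the law of total probability may
   be applied over this finite list. *)
have S1 : pr P (S @^-1` [set x | x \in l]) = 1.
  rewrite pr_seqT // big_map big_enum /= (eq_bigr _ (fun O _ => prS O)).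
  by rewrite -mulr_suml; exact (divff (lt0r_neq0 h_gt0)).
have S0 : pr P (~` (S @^-1` [set x | x \in l])) = 0.
  have := @pr_split _ _ _ P setT _ measurableT (mS [set x | x \in l]).
  by rewrite !setTI prT S1 -[X in X = _]addr0 => /addrI.
rewrite (pr_split P mX (mS [set x | x \in l])).
rewrite [X in _ + X](_ : _ = 0) ?addr0; last first.
  apply/eqP; rewrite eq_le pr_ge0 andbT -S0; apply: pr_le.
  - by apply: measurableI => //; apply: measurableC; exact: mS.
  - by apply: measurableC; exact: mS.
  - exact: subIsetr.
rewrite setIC (pr_seq P S_rand mX ul) big_map big_enum.
rewrite -(sum_remainder_prob rn) mulr_suml.
apply: eq_bigr => O _; rewrite /pr X_pr S_pr sz /=.
by rewrite mulrAC.
Qed.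

End RemainderDistribution.

Lemma pseries_sum_fin (R : realType) (a : nat -> R) (z : R) :
  (forall n, 0 <= a n) -> 0 <= z -> (pseries_sum a z < +oo)%E ->
  pseries_sum a z = (fine (pseries_sum a z))%:E.
Proof.
move=> a0 z0 fin; rewrite fineK // ge0_fin_numE //.
by apply: nneseries_ge0 => n _ _; rewrite lee_fin mulr_ge0 // exprn_ge0.
Qed.

Lemma pseries_sum_cvg (R : realType) (a : nat -> R) (z : R) :
  (forall n, 0 <= a n) -> 0 <= z -> (pseries_sum a z < +oo)%E ->
  \sum_(0 <= i < n) a i * z ^+ i @[n --> \oo] --> fine (pseries_sum a z).
Proof.
move=> a0 z0 fin.
have h : ((\sum_(0 <= i < n) a i * z ^+ i)%:E @[n --> \oo] --> pseries_sum a z)%E.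
  under eq_cvg do rewrite -sumEFin.
  by apply: is_cvg_nneseries => n _ _; rewrite lee_fin mulr_ge0 // exprn_ge0.
rewrite (pseries_sum_fin a0 z0 fin) in h.
exact: (fine_cvg h).
Qed.

Lemma ratio_cancel (R : realType) (w a b x : R) : 0 < b -> 0 < x ->
  w * (a / b) / (x / b) = w * a / x.
Proof. by move=> b0 x0; field; rewrite !gt_eqF. Qed.

(** * The Boltzmann law and its normalising constant *)

Section BallProbability.
Variables (R : realType) (H : wspecies R) (dR : measure_display).
Variables (Omega : measurableType dR) (P : probability Omega R).
Variables (X : Omega -> unlabelled H) (rho : R).
Hypothesis X_dist : boltzmann_distributed P rho X.
Local Notation c := (fine (pseries_sum (ogs H) rho)).

Definition size_ball (M : nat) : seq (unlabelled H) :=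
  [seq @ball_elt R H M p | p <- enum ({m : 'I_M & unlabelled_of_size H m} : finType)].

Lemma size_ball_uniq M : uniq (size_ball M).
Proof. by rewrite map_inj_uniq ?enum_uniq //; exact: ball_elt_inj. Qed.

Lemma mem_size_ball M x : (x \in size_ball M) = (unl_size x < M)%N.
Proof.
rewrite -ball_eltP; apply/mapP/existsP => [[p _ ->]|[p /eqP <-]]; first by exists p.
by exists p; rewrite ?mem_enum.
Qed.

Lemma boltzmann_pr x : pr P (X @^-1` [set x]) = unl_weight x * rho ^+ unl_size x / c.
Proof. by case: X_dist => _ h; rewrite /pr h. Qed.

Lemma boltzmann_ball M : \sum_(x <- size_ball M) pr P (X @^-1` [set x]) =
  (\sum_(0 <= m < M) ogs H m * rho ^+ m) / c.
Proof.
rewrite (eq_bigr _ (fun x _ => boltzmann_pr x)) big_map big_enum.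
rewrite (@ball_sum R H M _ (fun x => unl_weight x * rho ^+ unl_size x / c)).
rewrite big_mkord mulr_suml; apply: eq_bigr => m _.
by rewrite /ogs !mulr_suml; apply: eq_bigr => O _.
Qed.

(** Continuity from below of the probability measure along the increasing events that the size is
    below [M]. *)
Lemma boltzmann_ball_cvg :
  (\sum_(0 <= m < M) ogs H m * rho ^+ m) / c @[M --> \oo] --> (1 : R).
Proof.
have [X_rand _] := X_dist.
pose B (M : nat) := X @^-1` [set x | x \in size_ball M].
have mB M : measurable (B M) by exact: X_rand.
have BT : \bigcup_M B M = setT.
  apply/seteqP; split => // w _; exists (unl_size (X w)).+1 => //.
  by rewrite /B /= mem_size_ball.
have ndB : nondecreasing_seq B.
  move=> m n mn; apply/subsetPset => w; rewrite /B /= !mem_size_ball => h.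
  exact: leq_trans h mn.
have mBT : measurable (\bigcup_M B M) by rewrite BT.
have h : (P \o B) M @[M --> \oo] --> P (\bigcup_M B M) := nondecreasing_cvg_mu mB mBT ndB.
have PT : P (\bigcup_M B M) = 1%E by rewrite BT; exact: probability_setT.
rewrite PT in h.
have {}h : ((\sum_(0 <= m < M) ogs H m * rho ^+ m) / c)%:E @[M --> \oo] --> (1%:E : \bar R).
  apply: cvg_trans h; apply: near_eq_cvg; near=> M.
  by rewrite /= -boltzmann_ball -(pr_seqT P X_rand (size_ball_uniq M)) -prE.
exact: (fine_cvg h).
Unshelve. all: by end_near. Qed.

Hypothesis rho_gt0 : 0 < rho.

(** If [c] were 0, which includes a divergent series since [fine] sends [+oo] to 0, all point masses
    would be 0 by the convention on [0^-1], contradicting total mass 1. *)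
Lemma boltzmann_partition_gt0 : 0 < c.
Proof.
have c0 : 0 <= c.
  apply: fine_ge0; apply: nneseries_ge0 => n _ _.
  by rewrite lee_fin mulr_ge0 ?ogs_ge0 // exprn_ge0 // ltW.
rewrite lt0r c0 andbT; apply/eqP => e.
have := boltzmann_ball_cvg; rewrite e.
under eq_cvg do rewrite invr0 mulr0.
move=> /(cvg_lim (@Rhausdorff R)); rewrite (cvg_lim (@Rhausdorff R) (cvg_cst (0 : R))).
by move/eqP; rewrite eq_sym oner_eq0.
Qed.

(** Finiteness of the normalising series is read off from the existence of the Boltzmann law: its
    partial sums divided by [c] tend to 1. *)
Lemma boltzmann_partition_cvg :
  \sum_(0 <= m < M) ogs H m * rho ^+ m @[M --> \oo] --> c.
Proof.
have h : (\sum_(0 <= m < M) ogs H m * rho ^+ m) / c * c @[M --> \oo] --> 1 * c.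
  by apply: cvgM; [exact: boltzmann_ball_cvg | exact: cvg_cst].
rewrite mul1r in h; apply: cvg_near_eq h _; near=> M.
by rewrite divfK // gt_eqF // boltzmann_partition_gt0.
Unshelve. all: by end_near. Qed.

End BallProbability.

Theorem theorem3p1 (R : realType) (F G : wspecies R) (rho eps : R) (d : nat)
  (dS : nat -> measure_display) (OmegaS : forall n, measurableType (dS n))
  (PS : forall n, probability (OmegaS n) R)
  (S_ : forall n, OmegaS n -> unlabelled (species_comp F G))
  (R_ : forall n, OmegaS n -> unlabelled (species_comp (derived F) G))
  (dR : measure_display) (OmegaR : measurableType dR)
  (PR : probability OmegaR R)
  (Rlim : OmegaR -> unlabelled (species_comp (derived F) G)) :
  #|G void| = 0%N ->
  (exists2 k, (1 <= k)%N & 0 < ogs F k) ->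
  ~ (exists N, forall n, (N <= n)%N -> ogs (species_comp F G) n = 0) ->
  conv_radius (ogs G) = rho%:E ->
  0 < eps ->
  (cycle_index F (fun i =>
     if i == 1%N then pseries_sum (ogs G) rho + eps%:E
     else pseries_sum (ogs (species_pow G i)) ((rho + eps) ^+ i)) < +oo)%E ->
  (forall n, 0 < ogs (species_comp F G) n ->
     weight_distributed (PS n) n (S_ n)) ->
  (forall n, (1 <= n)%N -> 0 < ogs (species_comp F G) n ->
     remainder_of (PS n) (S_ n) (R_ n)) ->
  boltzmann_distributed PR rho Rlim ->
  (1 <= d)%N ->
  class_S d (ogs G) ->
  dTV (PS n) PR (R_ n) Rlim @[n --> oo_mod d] --> 0%E.
Proof.
move=> _ _ _ radius eps_gt0 Z_fin S_dist R_dist Rlim_dist _.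
case=> rho' [rho_gt0 [radius' [g_ge0 [g_dvd [g_ratio [g_fin g_conv]]]]]].
(* The class [class_S] brings its own radius, which is identified with [rho]. *)
have {radius radius'} e : rho' = rho by apply: EFin_inj; rewrite -radius -radius'.
subst rho'.
set s := fine (pseries_sum (ogs G) rho) in g_conv.
have g_sum := pseries_sum_cvg g_ge0 (ltW rho_gt0) g_fin.
rewrite (pseries_sum_fin g_ge0 (ltW rho_gt0) g_fin) -/s in Z_fin.
set h := ogs (species_comp F G) in S_dist R_dist.
set c := fine (pseries_sum (ogs (species_comp (derived F) G)) rho).
have c_gt0 : 0 < c := boltzmann_partition_gt0 Rlim_dist rho_gt0.
have c_sum := boltzmann_partition_cvg Rlim_dist rho_gt0.
have h_ratio : h n / ogs G n @[n --> oo_mod d] --> c :=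
  ogs_comp_ratio rho_gt0 eps_gt0 g_dvd g_ratio g_sum g_conv Z_fin c_sum.
have g_gt0 := subexp_gt0 rho_gt0 g_ge0 g_ratio.
have h_gt0 : \forall n \near oo_mod d, 0 < h n.
  have h1 : \forall n \near oo_mod d, 0 < h n / ogs G n by apply: (cvgr_gt _ h_ratio).
  near=> n; have gn : 0 < ogs G n by near: n.
  by rewrite -(pmulr_lgt0 _ (_ : 0 < (ogs G n)^-1)) ?invr_gt0 //; near: n.
have pointwise r : pr (PS n) (R_ n @^-1` [set r]) @[n --> oo_mod d] -->
    pr PR (Rlim @^-1` [set r]).
  rewrite (boltzmann_pr Rlim_dist) -/c; set m := unl_size r.
  have near_pr : \forall n \near oo_mod d, unl_weight r * (ogs G (n - m) / ogs G n) / (h n / ogs G n) =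
      pr (PS n) (R_ n @^-1` [set r]).
    near=> n.
    have hn : 0 < h n by near: n.
    have gn : 0 < ogs G n by near: n.
    have mn : (m + m < n)%N by near: n; exact: oo_mod_ge.
    have n0 : (0 < n)%N := leq_ltn_trans (leq0n _) mn.
    rewrite (remainder_pr (S_dist n hn) (R_dist n n0 hn) hn mn) -/h -/m.
    exact: ratio_cancel.
  apply: cvg_near_eq near_pr.
  (* If [d] does not divide the size of [r], its weight is 0 and so are both probabilities;
     otherwise the shift by [m] has the limit [rho ^+ m]. *)
  have [dm|ndm] := boolP (d %| m)%N.
    apply: cvgM; last by apply: cvgV => //; rewrite gt_eqF.
    by apply: cvgM; [exact: cvg_cst | exact: subexp_shift].
  have w0 : unl_weight r = 0 := comp_unl_weight_dvd g_dvd ndm.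
  rewrite w0 !mul0r; apply: cvg_near_eq (cvg_cst (0 : R)) _.
  by near=> n; rewrite !mul0r.
have [Rlim_rand _] := Rlim_dist.
have bound (e : R) : 0 < e -> \forall n \near oo_mod d,
    (dTV (PS n) PR (R_ n) Rlim <= e%:E)%E.
  move=> e0; have e40 : 0 < e / 4 by rewrite divr_gt0.
  (* A finite ball carries all but [e / 4] of the limit law. With an error below [e / 4] on the
     ball, the two doubled terms of [dTV_le] add up to at most [e]. *)
  have /cvgrPdist_le/(_ _ e40)[M _ /(_ M (leqnn M)) /= hM] := boltzmann_ball_cvg Rlim_dist.
  rewrite -(boltzmann_ball Rlim_dist) in hM.
  set l := size_ball _ M in hM.
  have diff_cvg : \sum_(x <- l) `|pr (PS n) (R_ n @^-1` [set x]) - pr PR (Rlim @^-1` [set x])|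
      @[n --> oo_mod d] --> \sum_(x <- l) (0 : R).
    apply: cvg_big => [|x _]; first exact: add_continuous.
    rewrite -(normr0 R) -(subrr (pr PR (Rlim @^-1` [set x]))).
    by apply: cvg_norm; apply: cvgB; [exact: pointwise | exact: cvg_cst].
  rewrite big1_eq in diff_cvg.
  have near_diff : \forall n \near oo_mod d,
      \sum_(x <- l) `|pr (PS n) (R_ n @^-1` [set x]) - pr PR (Rlim @^-1` [set x])| < e / 4.
    exact: (cvgr_lt _ diff_cvg).
  near=> n.
  have hn : 0 < h n by near: n.
  have n0 : (0 < n)%N by near: n; exact: oo_mod_ge.
  have [Rn_rand _] := R_dist n n0 hn.
  have hb := dTV_le (PS n) PR Rn_rand Rlim_rand (size_ball_uniq _ M).
  apply: (le_trans hb).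
  rewrite lee_fin -/l.
  have h1 : \sum_(x <- l) `|pr (PS n) (R_ n @^-1` [set x]) -
      pr PR (Rlim @^-1` [set x])| < e / 4 by near: n.
  move: hM; rewrite ler_norml => /andP[_ h2].
  lra.
have dTV0 n : (0 <= dTV (PS n) PR (R_ n) Rlim)%E := dTV_ge0 _ _ _ _.
apply/fine_cvgP; split.
  have b1 := bound 1 ltr01; near=> n.
  rewrite ge0_fin_numE //; apply: (@le_lt_trans _ _ 1%:E); last exact: ltry.
  by near: n.
apply/cvgrPdist_le => e e0; have be := bound e e0; near=> n.
have dn : (dTV (PS n) PR (R_ n) Rlim <= e%:E)%E by near: n.
rewrite sub0r normrN ger0_norm ?fine_ge0 //.
rewrite -lee_fin fineK // ge0_fin_numE //; exact: (le_lt_trans dn (ltry _)).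
Unshelve. all: by end_near. Qed.
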